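(* Let $\{f_t:t\in\mathbb{N}\}$ be a countably infinite set of scaling functions totally ordered by domination. For each $t\in\mathbb{N}$ let $\Xi_t$ be any scale limit. Let $\Gamma$ be any permuton and $\Lambda$ any permutation local limit. Then there exists a sequence of permutations $(\tau_m)_{m\in\mathbb{N}}$ with $|\tau_m|\to\infty$ which converges to $\Xi_t$ at scale $f_t$ for every $t\in\mathbb{N}$, converges globally to $\Gamma$, and converges locally to $\Lambda$.
   Context: For $g,h:\mathbb{N}\to\mathbb{R}^+$ write $g\ll h$ if $g(n)/h(n)\to0$. A scaling function is a function $f:\mathbb{N}\to\mathbb{R}^+$ with $f(n)\le n$ for all $n$, $f(n)\to\infty$ and $f(n)/n\to 0$. A set of scaling functions is totally ordered by domination if for every two distinct members $f,g$ either $f\ll g$ or $g\ll f$. Let $S_n$ be the set of permutations of $[n]$ and $S=\bigcup_nS_n$. An occurrence of $\pi\in S_k$ in $\sigma\in S_n$ is a set of indices $i_1<\dots<i_k$ with $\sigma(i_1)\dots\sigma(i_k)$ order-isomorphic to $\pi$; its width is $i_k-i_1+1$. For real $f\in[k,n]$, $\rho_f(\pi,\sigma)$ is the number of occurrences of $\pi$ in $\sigma$ of width at most $f$ divided by the number of $k$-subsets of $[n]$ of width at most $f$; the global density is $\rho(\pi,\sigma)=\rho_n(\pi,\sigma)$ and the local density is $\rho_k(\pi,\sigma)$ (consecutive occurrences). A sequence $(\sigma_j)$ with $|\sigma_j|\to\infty$ converges at scale $f$ to $\Xi\in[0,1]^S$ if $\rho_{f(|\sigma_j|)}(\pi,\sigma_j)\to\Xi_\pi$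 for all $\pi\in S$; a scale limit is a $\Xi$ arising in this way for some scaling function and some sequence. The sequence converges locally to $\Lambda\in[0,1]^S$ if $\rho_{|\pi|}(\pi,\sigma_j)\to\Lambda_\pi$ for all $\pi$; a permutation local limit is a $\Lambda$ arising in this way. A permuton is a Borel probability measure $\Gamma$ on $[0,1]^2$ with uniform marginals; $\rho(\pi,\Gamma)$ is the probability that $k=|\pi|$ independent $\Gamma$-distributed points, listed in increasing order of $x$-coordinate, have $y$-coordinates order-isomorphic to $\pi$. The sequence converges globally to $\Gamma$ if $\rho(\pi,\sigma_j)\to\rho(\pi,\Gamma)$ for all $\pi$. *)

(* Defs.v *)
From HB Require Import structures.
From mathcomp Require Import all_boot all_order all_algebra all_fingroup.
From mathcomp Require Import all_classical all_reals all_analysis.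
Set Implicit Arguments. Unset Strict Implicit. Unset Printing Implicit Defensive.
Import Order.TTheory GRing.Theory Num.Theory.
Import numFieldNormedType.Exports.
Local Open Scope classical_set_scope.
Local Open Scope ring_scope.

(* Permutations of [k] are elements of 'S_k (acting on {0,..,k-1});
   S = union of all S_k is represented by the dependent pairs {k & 'S_k},
   and an element of [0,1]^S by a function  forall k, 'S_k -> R. *)

Definition pval k (pi : 'S_k) (a : nat) : nat :=
  if insub a is Some i then val (pi i) else 0%N.

Definition rk n (I : {set 'I_n}) (i : 'I_n) : nat := #|[set j in I | (j < i)%N]|.

(* I is (the index set of) an occurrence of pi in sigma:
   I = {i_1 < ... < i_k} and sigma(i_1)...sigma(i_k) is order-isomorphic to pi *)
Definition is_occ k n (pi : 'S_k) (sigma : 'S_n) (I : {set 'I_n}) : bool :=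
  (#|I| == k) &&
  [forall i in I, forall j in I, (i < j)%N ==>
     ((sigma i < sigma j)%N == (pval pi (rk I i) < pval pi (rk I j))%N)].

(* width i_k - i_1 + 1 of a nonempty index set (0 for the empty set) *)
Definition width n (I : {set 'I_n}) : nat :=
  (\max_(i in I) \max_(j in I) (val j - val i).+1)%N.

(* rho_x(pi, sigma): occurrences of width <= x divided by k-subsets of
   width <= x  (only meaningful for x in [k, n]) *)
Definition rho (R : realType) (x : R) k n (pi : 'S_k) (sigma : 'S_n) : R :=
  (#|[set I : {set 'I_n} | is_occ pi sigma I && ((width I)%:R <= x)]|%:R) /
  (#|[set I : {set 'I_n} | (#|I| == k) && ((width I)%:R <= x)]|%:R).

Definition sizes_to_infty (s : nat -> {n : nat & 'S_n}) : Prop :=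
  forall N : nat, exists J : nat, forall j : nat, (J <= j)%N -> (N <= projT1 (s j))%N.

Definition dominated (R : realType) (g h : nat -> R) : Prop :=
  (fun n => g n / h n) @ \oo --> (0 : R).

(* scaling function (the natural numbers being {1,2,...}) *)
Definition scaling (R : realType) (f : nat -> R) : Prop :=
  [/\ forall n : nat, (0 < n)%N -> 0 < f n /\ f n <= n%:R,
      f @ \oo --> +oo &
      (fun n => f n / n%:R) @ \oo --> (0 : R)].

Definition conv_scale (R : realType) (f : nat -> R) (s : nat -> {n : nat & 'S_n})
    (Xi : forall k, 'S_k -> R) : Prop :=
  sizes_to_infty s /\
  forall k (pi : 'S_k),
    (fun j => rho (f (projT1 (s j))) pi (projT2 (s j))) @ \oo --> Xi k pi.

Definition scale_limit (R : realType) (Xi : forall k, 'S_k -> R) : Prop :=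
  exists (f : nat -> R) (s : nat -> {n : nat & 'S_n}), scaling f /\ conv_scale f s Xi.

(* local convergence: consecutive pattern densities rho_{|pi|} *)
Definition conv_local (R : realType) (s : nat -> {n : nat & 'S_n})
    (Lam : forall k, 'S_k -> R) : Prop :=
  sizes_to_infty s /\
  forall k (pi : 'S_k),
    (fun j => rho (k%:R : R) pi (projT2 (s j))) @ \oo --> Lam k pi.

Definition local_limit (R : realType) (Lam : forall k, 'S_k -> R) : Prop :=
  exists s : nat -> {n : nat & 'S_n}, conv_local s Lam.

(* permuton: a (Borel) measure on R^2 whose two marginals are the uniform
   (Lebesgue) measure on [0,1]; this forces total mass 1 and support in [0,1]^2 *)
Definition permuton (R : realType) (G : {measure set (R * R)%type -> \bar R}) : Prop :=
  forall A : set R, measurable A ->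
    G (A `*` setT) = (@lebesgue_measure R) (A `&` [set x | 0 <= x <= 1]) /\
    G (setT `*` A) = (@lebesgue_measure R) (A `&` [set x | 0 <= x <= 1]).

(* k-fold iterated integral against G (= integral against the product
   measure G^k, by Tonelli, for nonnegative measurable F) *)
Fixpoint iint (R : realType) (G : {measure set (R * R)%type -> \bar R}) (k : nat)
    (F : seq (R * R) -> \bar R) : \bar R :=
  match k with
  | 0 => F [::]
  | k'.+1 => (\int[G]_p iint G k' (fun s => F (p :: s)))%E
  end.

(* the event that k points p_0..p_{k-1}, listed by increasing x-coordinate,
   have y-coordinates order-isomorphic to pi (x-coordinates distinct) *)
Definition pat_event (R : realType) k (pi : 'S_k) (s : seq (R * R)) : bool :=
  let x i := (nth (0, 0) s i).1 in
  let y i := (nth (0, 0) s i).2 in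
  let r i := #|[set j : 'I_k | x (val j) < x i]| in
  [forall i : 'I_k, forall j : 'I_k,
     ((i != j) ==> (x (val i) != x (val j))) &&
     ((x (val i) < x (val j)) ==>
        ((y (val i) < y (val j)) == (pval pi (r (val i)) < pval pi (r (val j)))%N))].

Definition rho_permuton (R : realType) (G : {measure set (R * R)%type -> \bar R})
    k (pi : 'S_k) : R :=
  fine (iint G k (fun s => ((pat_event pi s : nat)%:R)%:E)).

Definition conv_global (R : realType) (s : nat -> {n : nat & 'S_n})
    (G : {measure set (R * R)%type -> \bar R}) : Prop :=
  forall k (pi : 'S_k),
    (fun j => rho ((projT1 (s j))%:R : R) pi (projT2 (s j))) @ \oo --> rho_permuton G pi.

(* Main.v *)
Require Import Defs.
From HB Require Import structures.
From mathcomp Require Import all_boot all_order all_algebra all_fingroup.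
From mathcomp Require Import all_classical all_reals all_analysis.
From mathcomp Require Import measurable_realfun zify ring lra.
Set Implicit Arguments. Unset Strict Implicit. Unset Printing Implicit Defensive.
Import Order.TTheory GRing.Theory Num.Theory.
Import numFieldNormedType.Exports.
Local Open Scope ring_scope.

(** Replace every point of a permutation [beta] by a block of [c] points, filled
    with increasing copies of a permutation [tau] with [|tau|] much smaller than
    [c].  Up to small errors the result has the densities of [tau] at every scale
    much smaller than [|tau|], and at scale [a * c] it has the densities that
    [beta] has at scale [a].  Since [c] can be chosen freely, a scale limit can be
    realised at any prescribed scale.  So start from a permutation approximating
    the local limit and wrap it successively, in order of domination, into
    permutations approximating the scale limits of finitely many of the [f t], and
    finally into one approximating the permuton; then pass to a diagonal sequence.

    Both comparisons are instances of one principle: an injection that sends each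
    small [k]-subset to [m] large ones of the same pattern bounds the difference
    of the densities by the proportion of large [k]-subsets it misses.

    A permuton [G] is approximated through an [n] by [n] grid: the pattern of [k]
    points is determined by their cells unless two of them share a row or a column,
    an event of probability [O(k^2 / n)] both under [G] and for a permutation whose
    numbers of points in the cells are proportional to the masses of the cells. *)

Local Notation pval := Defs.pval.

(** * Occurrences and transfer of densities *)

(** The value at [i] is the number of indices with a smaller key, which is below [n] and strictly
    increasing in the key. *)
Lemma perm_of_key n (key : 'I_n -> nat) : injective key ->
  exists s : 'S_n, forall i j, (s i < s j)%N = (key i < key j)%N.
Proof.
move=> kinj; pose S i := [set j | (key j < key i)%N].
have SS i j : (key i < key j)%N -> S i \proper S j.
  move=> kij; rewrite properE; apply/andP; split.
    by apply/fintype.subsetP => l; rewrite !inE => /ltn_trans; apply.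
  by apply/fintype.subsetPn; exists i; rewrite !inE ?ltnn.
have Sn i : (#|S i| < n)%N.
  have /proper_card : S i \proper [set: 'I_n].
    by rewrite properE finset.subsetT; apply/fintype.subsetPn; exists i; rewrite ?inE ?ltnn.
  by rewrite cardsT card_ord.
pose f i := Ordinal (Sn i).
have fE i j : (f i < f j)%N = (key i < key j)%N.
  case: (ltngtP (key i) (key j)) => [/SS/proper_card ->//|/SS/proper_card/ltnW|/kinj->].
    by rewrite leqNgt => /negbTE.
  by rewrite ltnn.
have finj : injective f.
  move=> i j fij; apply: kinj; apply/eqP.
  by case: (ltngtP (key i)) => //; rewrite -fE fij ltnn.
by exists (perm finj) => i j; rewrite !permE fE.
Qed.

Lemma pvalE k (pi : 'S_k) (i : 'I_k) : pval pi i = pi i.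
Proof. by rewrite /pval insubT //= => lt; congr (val (pi _)); apply: val_inj. Qed.

Lemma pval_lt k (pi : 'S_k) a : (a < k)%N -> (pval pi a < k)%N.
Proof. by move=> ak; rewrite (pvalE pi (Ordinal ak)). Qed.

Lemma pval_inj k (pi : 'S_k) a b : (a < k)%N -> (b < k)%N ->
  pval pi a = pval pi b -> a = b.
Proof.
move=> ak bk; rewrite (pvalE pi (Ordinal ak)) (pvalE pi (Ordinal bk)).
by move=> /val_inj/perm_inj[].
Qed.

Section Occurrences.
Variables (k n m : nat) (pi : 'S_k) (sigma : 'S_n) (tau : 'S_m).
Variables (g : 'I_n -> 'I_m) (I : {set 'I_n}).
Hypothesis gmono : {in I &, forall i j : 'I_n, (i < j)%N -> (g i < g j)%N}.

Lemma strict_mono_ltn : {in I &, forall i j : 'I_n, (g i < g j)%N = (i < j)%N}.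
Proof.
move=> i j iI jI; case: (ltngtP i j) => [/gmono->//|/gmono h|/val_inj->].
  by apply/negbTE; rewrite -leqNgt ltnW // h.
by rewrite ltnn.
Qed.

Lemma strict_mono_inj : {in I &, injective g}.
Proof.
move=> i j iI jI gij; apply: val_inj; apply/eqP.
by case: ltngtP => //; rewrite -strict_mono_ltn // gij ltnn.
Qed.

Lemma rk_imset i : i \in I -> rk (g @: I) (g i) = rk I i.
Proof.
move=> iI; rewrite /rk.
have -> : [set j in g @: I | (j < g i)%N] = g @: [set j in I | (j < i)%N].
  apply/setP => j; rewrite !inE; apply/andP/imsetP.
    by case=> /imsetP[l lI ->]; rewrite strict_mono_ltn // => li; exists l; rewrite ?inE ?lI.
  case=> l; rewrite inE => /andP[lI li] ->.
  by rewrite strict_mono_ltn ?imset_f.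
rewrite card_in_imset // => a b; rewrite !inE => /andP[aI _] /andP[bI _].
exact: strict_mono_inj.
Qed.

Hypothesis gval : {in I &, forall i j : 'I_n, (i < j)%N ->
  (tau (g i) < tau (g j))%N = (sigma i < sigma j)%N}.

(** An occurrence compares values at pairs [i < j] with ranks inside the index set. A map increasing
    on [I] keeps the ranks, and [gval] keeps the comparisons of values. *)
Lemma is_occ_imset : is_occ pi tau (g @: I) = is_occ pi sigma I.
Proof.
rewrite /is_occ card_in_imset; last exact: strict_mono_inj.
congr (_ && _); apply/'forall_implyP/'forall_implyP => H.
  move=> i iI; apply/'forall_implyP => j jI; apply/implyP => ij.
  have /'forall_implyP /(_ _ (imset_f g jI)) := H _ (imset_f g iI).
  by rewrite strict_mono_ltn // ij /= gval // !rk_imset.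
move=> _ /imsetP[i iI ->]; apply/'forall_implyP => _ /imsetP[j jI ->].
apply/implyP; rewrite strict_mono_ltn // => ij.
have /'forall_implyP /(_ _ jI) := H _ iI.
by rewrite ij /= gval // !rk_imset.
Qed.

End Occurrences.

Lemma width_leP n (I : {set 'I_n}) x :
  reflect {in I &, forall i j : 'I_n, (j - i < x)%N} (width I <= x)%N.
Proof.
apply: (iffP idP) => [/bigmax_leqP H i j iI jI|H].
  by have /bigmax_leqP := H i iI; apply.
by apply/bigmax_leqP => i iI; apply/bigmax_leqP => j jI; exact: H.
Qed.

Definition ksub n k x : {set {set 'I_n}} :=
  [set I : {set 'I_n} | (#|I| == k) && (width I <= x)%N].

Definition occs k n (pi : 'S_k) (sigma : 'S_n) x : {set {set 'I_n}} :=
  [set I : {set 'I_n} | is_occ pi sigma I && (width I <= x)%N].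

Lemma occs_sub k n (pi : 'S_k) (sigma : 'S_n) x : occs pi sigma x \subset ksub n k x.
Proof. by apply/fintype.subsetP => I; rewrite !inE => /andP[/andP[-> _] ->]. Qed.

Section Rho.
Variable R : realType.

Lemma rhoE k n (pi : 'S_k) (sigma : 'S_n) (x : nat) :
  rho (x%:R : R) pi sigma = #|occs pi sigma x|%:R / #|ksub n k x|%:R.
Proof.
rewrite /rho; congr (_%:R / _%:R); apply: eq_card => I;
  by rewrite [RHS]inE -(ler_nat R); exact: asboolb.
Qed.

(** Widths are integers, so a real threshold acts through its integer part. This lets all counting
    be done with integer thresholds. *)
Lemma rho_truncn k n (pi : 'S_k) (sigma : 'S_n) (x : R) : 0 <= x ->
  rho x pi sigma = rho ((Num.truncn x)%:R : R) pi sigma.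
Proof.
move=> x0; rewrite rhoE /rho; congr (_%:R / _%:R); apply: eq_card => I;
  by rewrite [RHS]inE truncn_ge_nat //; exact: asboolb.
Qed.

Lemma rho_ge0 k n (pi : 'S_k) (sigma : 'S_n) (x : R) : 0 <= rho x pi sigma.
Proof. by rewrite /rho divr_ge0. Qed.

Lemma rho_le1 k n (pi : 'S_k) (sigma : 'S_n) (x : nat) :
  rho (x%:R : R) pi sigma <= 1.
Proof.
rewrite rhoE; have [->|K0] := eqVneq #|ksub n k x| 0%N; first by rewrite invr0 mulr0.
by rewrite ler_pdivrMr ?mul1r ?ltr0n ?lt0n // ler_nat subset_leq_card // occs_sub.
Qed.

(** The empty pattern is treated apart, because the counting below splits off the least element of a
    [k]-subset. *)
Lemma rho_card0 n (pi : 'S_0) (sigma : 'S_n) (x : nat) : rho (x%:R : R) pi sigma = 1.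
Proof.
have occE : occs pi sigma x = [set finset.set0].
  apply/setP => I; rewrite !inE /is_occ cards_eq0; case: eqP => //= ->.
  apply/andP; split; last by apply/width_leP => i; rewrite inE.
  by apply/'forall_implyP => i; rewrite inE.
have kE : ksub n 0 x = [set finset.set0].
  apply/setP => I; rewrite !inE cards_eq0; case: eqP => //= ->.
  by apply/width_leP => i; rewrite inE.
by rewrite rhoE occE kE cards1 divr1.
Qed.

Section Transfer.
Variables (k N n a x m : nat) (pi : 'S_k) (beta : 'S_N) (tau : 'S_n).
Variables (Q : finType) (V : {set 'I_N} -> {pred Q}).
Variable F : {set 'I_N} -> Q -> {set 'I_n}.
Hypothesis cardV : forall I, I \in ksub N k a -> #|V I| = m.
Hypothesis Fksub : forall I q, I \in ksub N k a -> q \in V I -> F I q \in ksub n k x.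
Hypothesis Focc : forall I q, I \in ksub N k a -> q \in V I ->
  is_occ pi tau (F I q) = is_occ pi beta I.
Hypothesis Finj : forall I q I' q', I \in ksub N k a -> q \in V I ->
  I' \in ksub N k a -> q' \in V I' -> F I q = F I' q' -> I = I' /\ q = q'.

Let D (A : {set {set 'I_N}}) := [set p : {set 'I_N} * Q | (p.1 \in A) && (p.2 \in V p.1)].

Let cardD (A : {set {set 'I_N}}) : A \subset ksub N k a -> #|D A| = (m * #|A|)%N.
Proof.
move=> /fintype.subsetP sA; rewrite -sum1_card.
rewrite (eq_bigl (fun p : {set 'I_N} * Q => (p.1 \in A) && (p.2 \in V p.1))); last first.
  by move=> p; rewrite inE.
rewrite -(pair_big_dep (mem A) (fun I q => q \in V I) (fun _ _ => 1%N)) /=.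
transitivity (\sum_(I in A) m)%N; last by rewrite sum_nat_const mulnC.
by apply: eq_bigr => I IA; rewrite sum1_card cardV ?sA.
Qed.

Let F2 p := F p.1 p.2.

Let F2inj (A : {set {set 'I_N}}) : A \subset ksub N k a -> {in D A &, injective F2}.
Proof.
move=> /fintype.subsetP sA [I q] [I' q']; rewrite !inE /= => /andP[IA qV] /andP[I'A q'V].
by move=> E; have [-> ->] := @Finj I q I' q' (sA _ IA) qV (sA _ I'A) q'V E.
Qed.

(** Pairs of a small [k]-subset and one of its [m] labels embed into the large [k]-subsets,
    occurrences going to occurrences and the others to the others. The last inequality is the count
    of the others, written without subtraction. *)
Lemma card_transfer : [/\ (m * #|ksub N k a| <= #|ksub n k x|)%N,
  (m * #|occs pi beta a| <= #|occs pi tau x|)%N &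
  (#|occs pi tau x| + m * #|ksub N k a| <= m * #|occs pi beta a| + #|ksub n k x|)%N].
Proof.
have sO := occs_sub pi beta a; have sT := occs_sub pi tau x.
have sN : ksub N k a :\: occs pi beta a \subset ksub N k a by exact: finset.subsetDl.
have H1 : (m * #|occs pi beta a| <= #|occs pi tau x|)%N.
  rewrite -cardD // -(card_in_imset (F2inj sO)); apply: subset_leq_card.
  apply/fintype.subsetP => J /imsetP[[I q] + ->]; rewrite !inE /= => /andP[/andP[occI wI] qV].
  have Ik : I \in ksub N k a by rewrite inE wI andbT; case/andP: occI.
  rewrite /F2 /= Focc // occI /=.
  by have := Fksub Ik qV; rewrite inE => /andP[].
have H2 : (m * #|ksub N k a :\: occs pi beta a| <= #|ksub n k x :\: occs pi tau x|)%N.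
  rewrite -cardD // -(card_in_imset (F2inj sN)); apply: subset_leq_card.
  apply/fintype.subsetP => J /imsetP[[I q] + ->]; rewrite !inE /= => /andP[/andP[occI kI] qV].
  have Ik : I \in ksub N k a by rewrite inE.
  rewrite /F2 /= Focc //; move: (Fksub Ik qV); rewrite inE => ->; rewrite andbT.
  have /andP[_ wI] := kI.
  by move: occI; rewrite wI andbT => /negbTE->.
have E1 := cardsID (occs pi beta a) (ksub N k a).
have E2 := cardsID (occs pi tau x) (ksub n k x).
rewrite (finset.setIidPr sO) in E1; rewrite (finset.setIidPr sT) in E2.
by split => //; nia.
Qed.

(** With [s] the small density and [A], [T] the numbers of small and large [k]-subsets,
    [card_transfer] places the number of large occurrences minus [s * T] between [- s * (T - m * A)]
    and [(1 - s) * (T - m * A)]. *)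
Lemma rho_transfer : `|rho (x%:R : R) pi tau - rho (a%:R : R) pi beta| <=
  1 - (m * #|ksub N k a|)%:R / #|ksub n k x|%:R.
Proof.
have [H0 H1 H2] := card_transfer.
have [r0 r1] := (rho_ge0 pi tau (x%:R : R), rho_le1 pi tau x).
have [s0 s1] := (rho_ge0 pi beta (a%:R : R), rho_le1 pi beta a).
have : 0 <= 1 :> R by [].
(* If either family of [k]-subsets is empty, division by zero yields zero and the bound becomes
   1. *)
have [T0|T0] := posnP #|ksub n k x|.
  by rewrite T0 invr0 mulr0 subr0 ler_norml => _; lra.
have [A0|A0] := posnP #|ksub N k a|.
  by rewrite A0 muln0 mul0r subr0 ler_norml => _; lra.
move: r0 r1 s0 s1; rewrite !rhoE.
set T := #|ksub n k x| in T0 H0 H1 H2 *; set A := #|ksub N k a| in A0 H0 H1 H2 *.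
set O := #|occs pi tau x| in H1 H2 *; set P := #|occs pi beta a| in H1 H2 *.
move=> _ _ s0 s1 _.
have TT : 0 < T%:R :> R by rewrite ltr0n.
have AA : 0 < A%:R :> R by rewrite ltr0n.
have PE : P%:R = (P%:R / A%:R) * A%:R :> R by rewrite divfK // gt_eqF.
move: H0 H1 H2; rewrite -(ler_nat R) -(ler_nat R) -(ler_nat R) !natrD !natrM.
rewrite {1 2}PE; set s := P%:R / A%:R in s0 s1 *.
set O' := O%:R : R; set m' := m%:R : R; set A' := A%:R : R; set T' := T%:R : R.
move=> H0 H1 H2.
have -> : O' / T' - s = (O' - s * T') / T' by field; rewrite gt_eqF.
have -> : 1 - m' * A' / T' = (T' - m' * A') / T' by field; rewrite gt_eqF.
rewrite normrM (ger0_norm (x := T'^-1)) ?invr_ge0 ?(ltW TT) //.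
rewrite ler_pM2r ?invr_gt0 // ler_norml; apply/andP; split; nra.
Qed.

End Transfer.
End Rho.

(** * Wrapping one permutation into another *)

Lemma count_window n i x : (i < n)%N -> (0 < x)%N ->
  count (fun j => i < j < i + x)%N (iota 0 n) = minn x.-1 (n - i.+1).
Proof.
move=> iN x0.
have [xn|xn] := leqP (i + x) n.
  have {1}-> : n = ((i.+1 + x.-1) + (n - (i + x)))%N by lia.
  rewrite !iotaD !count_cat (@eq_in_count _ _ pred0 (iota 0 i.+1)); last first.
    by move=> j; rewrite mem_iota /=; lia.
  rewrite (@eq_in_count _ _ predT (iota (0 + i.+1) _)); last first.
    by move=> j; rewrite mem_iota /=; lia.
  rewrite (@eq_in_count _ _ pred0 (iota _ (_ - _))); last first.
    by move=> j; rewrite mem_iota /=; lia.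
  by rewrite !count_pred0 count_predT size_iota; lia.
have {1}-> : n = (i.+1 + (n - i.+1))%N by lia.
rewrite !iotaD !count_cat (@eq_in_count _ _ pred0 (iota 0 i.+1)); last first.
  by move=> j; rewrite mem_iota /=; lia.
rewrite (@eq_in_count _ _ predT (iota (0 + i.+1) _)); last first.
  by move=> j; rewrite mem_iota /=; lia.
by rewrite !count_pred0 count_predT size_iota; lia.
Qed.

(** * Counting [k]-subsets of bounded width *)

Section Counting.
Variables (n k x : nat).
Hypotheses (k0 : (0 < k)%N) (x0 : (0 < x)%N).

Let W (i : 'I_n) : {set 'I_n} := [set j : 'I_n | (i < j < i + x)%N].
Let S (i : 'I_n) : {set {set 'I_n}} :=
  [set J : {set 'I_n} | (J \subset W i) && (#|J| == k.-1)].

Let cardS i : #|S i| = 'C(#|W i|, k.-1).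
Proof. exact: cards_draws. Qed.

Let cardW (i : 'I_n) : #|W i| = minn x.-1 (n - i.+1).
Proof.
have -> : #|W i| = count (fun j => i < j < i + x)%N (iota 0 n).
  rewrite -sum1_card (eq_bigl (fun j : 'I_n => (i < j < i + x)%N)); last first.
    by move=> j; rewrite inE.
  by rewrite -(big_mkord (fun j => i < j < i + x)%N (fun=> 1%N)) sum1_count /index_iota subn0.
exact: count_window.
Qed.

Let D := [set p : 'I_n * {set 'I_n} | p.2 \in S p.1].

Let F (p : 'I_n * {set 'I_n}) : {set 'I_n} := p.1 |: p.2.

Let mem_D i J : (i, J) \in D ->
  [/\ {in J, forall j : 'I_n, (i < j < i + x)%N}, i \notin J & #|J| = k.-1].
Proof.
rewrite !inE => /andP[/fintype.subsetP sJ /eqP cJ]; split => //.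
  by move=> j /sJ; rewrite inE.
by apply/negP => /sJ; rewrite inE ltnn.
Qed.

Let Finj : {in D &, injective F}.
Proof.
move=> [i J] [i' J'] /mem_D[WJ iJ _] /mem_D[WJ' iJ' _] /setP; rewrite /F /= => E.
have ii' : i = i'.
  apply: val_inj => /=.
  have := E i; have := E i'; rewrite !inE !eqxx /= => /orP[/eqP->//|i'J] /esym/orP[/eqP->//|iJ'2].
  by have /andP[a _] := WJ _ i'J; have /andP[b _] := WJ' _ iJ'2; lia.
subst i'; congr pair; apply/setP => j; have := E j; rewrite !inE.
by case: eqP => // ->; rewrite (negbTE iJ) (negbTE iJ').
Qed.

Let imF : F @: D = ksub n k x.
Proof.
apply/setP => I; apply/imsetP/idP.
  case=> -[i J] /mem_D[WJ iJ cJ] -> ; rewrite inE /F /= cardsU1 iJ cJ /=.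
  apply/andP; split; first by rewrite addnC addn1 prednK.
  apply/width_leP => a b; rewrite !inE => /predU1P[->|/WJ aJ] /predU1P[->|/WJ bJ]; lia.
rewrite inE => /andP[/eqP cI /width_leP wI].
have /card_gt0P[i1 i1I] : (0 < #|I|)%N by rewrite cI.
have [i iI' imin] := arg_minnP val i1I; have iI : i \in I := iI'.
exists (i, I :\ i); last by rewrite /F /= finset.setD1K.
rewrite !inE /=; apply/andP; split; last by rewrite -cI (cardsD1 i I) iI.
apply/fintype.subsetP => j; rewrite !inE => /andP[ji jI].
have := imin _ jI; have := wI _ _ iI jI.
by move: ji; rewrite -val_eqE /=; lia.
Qed.

(** Split off the least element [i]: the other [k - 1] elements range freely over the [x - 1]
    positions after [i], cut off at [n]. *)
Lemma card_ksub : #|ksub n k x| = (\sum_(i < n) 'C(minn x.-1 (n - i.+1), k.-1))%N.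
Proof.
rewrite -imF (card_in_imset Finj) -sum1_card.
rewrite (eq_bigl (fun p : 'I_n * {set 'I_n} => true && (p.2 \in S p.1))); last first.
  by move=> p; rewrite inE.
rewrite -(pair_big_dep xpredT (fun i J => J \in S i) (fun _ _ => 1%N)) /=.
by apply: eq_bigr => i _; rewrite sum1_card cardS cardW.
Qed.

Lemma card_ksub_gt0 : (k <= x)%N -> (k <= n)%N -> (0 < #|ksub n k x|)%N.
Proof.
move=> kx kn; rewrite card_ksub.
case: n kn => [|n'] kn; first lia.
by rewrite big_ord_recl /= ltn_addr // bin_gt0; lia.
Qed.

Lemma card_ksub_le : (#|ksub n k x| <= n * 'C(x.-1, k.-1))%N.
Proof.
rewrite card_ksub -[X in (_ <= X * _)%N](card_ord n) -sum_nat_const.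
by apply: leq_sum => i _; rewrite leq_bin2l // geq_minl.
Qed.

(** Only windows starting at one of the last [x] positions can be cut off. Together with
    [card_ksub_le] this determines the count up to a factor [1 - x / n]. *)
Lemma card_ksub_ge : ((n - x) * 'C(x.-1, k.-1) <= #|ksub n k x|)%N.
Proof.
rewrite card_ksub -[X in (X * _)%N](card_ord (n - x)) -sum_nat_const.
have nx : (n - x <= n)%N by lia.
rewrite (big_ord_widen n (fun=> 'C(x.-1, k.-1)) nx) big_mkcond /=.
apply: leq_sum => i _; case: ifP => // ix.
by rewrite leq_bin2l //; lia.
Qed.

End Counting.

Lemma card_ksub_full n k : #|ksub n k n| = 'C(n, k).
Proof.
transitivity 'C(#|'I_n|, k); last by rewrite card_ord.
rewrite -card_draws; apply: eq_card => I; rewrite !inE.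
rewrite andb_idr // => _; apply/width_leP => i j _ _.
by apply: leq_ltn_trans (ltn_ord j); apply: leq_subr.
Qed.

(** Lexicographic comparison in base [B]; it serves for the keys of [combine], for positions in
    blocks and for the values in [perm_of_cell_counts]. *)
Lemma ltn_digit B p q u v : (u < B)%N -> (v < B)%N -> p != q ->
  (p * B + u < q * B + v)%N = (p < q)%N.
Proof.
move=> uB vB; case: (ltngtP p q) => // pq _.
  have : (p.+1 * B <= q * B)%N by rewrite leq_mul2r pq orbT.
  by rewrite mulSn; lia.
have : (q.+1 * B <= p * B)%N by rewrite leq_mul2r pq orbT.
by rewrite mulSn; lia.
Qed.

Lemma block_distance a c x i j u v : (u < c)%N -> (v < c)%N ->
  (j - i < a)%N -> (a * c <= x)%N -> (j * c + v - (i * c + u) < x)%N.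
Proof.
move=> uc vc ja acx.
have : ((j - i).+1 * c <= a * c)%N by rewrite leq_mul2r ja orbT.
by rewrite mulSn mulnBl; lia.
Qed.

(** * The wrapped permutation and its fine and coarse transfers *)

Section Combine.
Variables (N M c : nat) (beta : 'S_N) (alpha : 'S_M).
Hypotheses (M0 : (0 < M)%N) (c0 : (0 < c)%N).

(* Order by block first, then by copy of [alpha] inside the block (the last copy
   is truncated), then by the value of [alpha]. *)
Definition combine_key (i : nat) : nat :=
  (pval beta (i %/ c) * (c + M) + i %% c %/ M * M + pval alpha (i %% c %% M))%N.

(** The truncated last copy still uses values of [alpha] up to [M - 1], so an offset inside a block
    may reach [c] or more; hence the base [c + M] of the key. *)
Lemma combine_key_lt i : (i %% c %/ M * M + pval alpha (i %% c %% M) < c + M)%N.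
Proof.
have := pval_lt alpha (ltn_pmod (i %% c) M0).
by have := leq_trunc_div (i %% c) M; have := ltn_pmod i c0; lia.
Qed.

Lemma combine_key_inj : injective (fun i : 'I_(N * c) => combine_key i).
Proof.
move=> i j; rewrite /combine_key -!addnA => H.
have bi : (i %/ c < N)%N by rewrite ltn_divLR.
have bj : (j %/ c < N)%N by rewrite ltn_divLR.
have lti := combine_key_lt i; have ltj := combine_key_lt j.
have cM : (0 < c + M)%N by lia.
have E1 : pval beta (i %/ c) = pval beta (j %/ c).
  move: H => /(congr1 (fun z => z %/ (c + M))%N).
  by rewrite !divnMDl // (divn_small lti) (divn_small ltj) !addn0.
have Eb := pval_inj bi bj E1.
rewrite E1 in H; move: H => /addnI H.
have lai := pval_lt alpha (ltn_pmod (i %% c) M0).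
have laj := pval_lt alpha (ltn_pmod (j %% c) M0).
have E2 : (i %% c %/ M = j %% c %/ M)%N.
  move: H => /(congr1 (fun z => z %/ M)%N).
  by rewrite !divnMDl // (divn_small lai) (divn_small laj) !addn0.
rewrite E2 in H; move: H => /addnI H.
have E3 := pval_inj (ltn_pmod _ M0) (ltn_pmod _ M0) H.
apply: val_inj => /=; rewrite (divn_eq i c) (divn_eq j c) Eb; congr addn.
by rewrite (divn_eq (i %% c) M) (divn_eq (j %% c) M) E2 E3.
Qed.

Definition combine : 'S_(N * c) := sval (cid (perm_of_key combine_key_inj)).

Lemma combine_lt (i j : 'I_(N * c)) :
  (combine i < combine j)%N = (combine_key i < combine_key j)%N.
Proof. by rewrite /combine; case: cid. Qed.

Lemma combine_coarse (i j : 'I_(N * c)) : (i %/ c != j %/ c)%N ->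
  (combine i < combine j)%N = (pval beta (i %/ c) < pval beta (j %/ c))%N.
Proof.
move=> ij; rewrite combine_lt /combine_key -!addnA.
have bi : (i %/ c < N)%N by rewrite ltn_divLR.
have bj : (j %/ c < N)%N by rewrite ltn_divLR.
have : pval beta (i %/ c) != pval beta (j %/ c).
  by apply/eqP => /(pval_inj bi bj); apply/eqP.
by apply: ltn_digit; exact: combine_key_lt.
Qed.

Lemma combine_fine (i j : 'I_(N * c)) : (i %/ c = j %/ c)%N ->
  (i %% c %/ M = j %% c %/ M)%N ->
  (combine i < combine j)%N =
  (pval alpha (i %% c %% M) < pval alpha (j %% c %% M))%N.
Proof.
by move=> ij ijM; rewrite combine_lt /combine_key ij ijM ltn_add2l.
Qed.

Variable R : realType.

Section Fine.
Variables (k x : nat) (pi : 'S_k).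
Hypothesis k0 : (0 < k)%N.

Let Q : finType := ('I_N * 'I_(c %/ M))%type.

Let shift_lt (q : Q) (r : 'I_M) : (q.2 * M + r < c)%N.
Proof.
have /= := ltn_ord q.2; have := ltn_ord r; have := leq_trunc_div c M.
by move=> *; nia.
Qed.

Let shift_lt2 (q : Q) (r : 'I_M) : (q.1 * c + (q.2 * M + r) < N * c)%N.
Proof. by have := shift_lt q r; have := ltn_ord q.1; nia. Qed.

Let shift (q : Q) (r : 'I_M) : 'I_(N * c) := Ordinal (shift_lt2 q r).

Let shift_div q r : (shift q r %/ c = q.1)%N.
Proof. by rewrite /= divnMDl // (divn_small (shift_lt q r)) addn0. Qed.

Let shift_mod q r : (shift q r %% c = q.2 * M + r)%N.
Proof. by rewrite /= modnMDl (modn_small (shift_lt q r)). Qed.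

Let shift_moddiv q r : (shift q r %% c %/ M = q.2)%N.
Proof. by rewrite shift_mod divnMDl // (divn_small (ltn_ord r)) addn0. Qed.

Let shift_modmod q r : (shift q r %% c %% M = r)%N.
Proof. by rewrite shift_mod modnMDl (modn_small (ltn_ord r)). Qed.

(** The labels are the [N * (c %/ M)] complete copies of [alpha], and a [k]-subset is translated
    into each of them. The subsets missed straddle two copies or meet a truncated one. *)
Lemma rho_combine_fine_transfer :
  `|rho (x%:R : R) pi combine - rho (x%:R : R) pi alpha| <=
  1 - (N * (c %/ M) * #|ksub M k x|)%:R / #|ksub (N * c) k x|%:R.
Proof.
have smono q (I : {set 'I_M}) :
    {in I &, forall i j : 'I_M, (i < j)%N -> (shift q i < shift q j)%N}.
  by move=> i j _ _ /=; rewrite !ltn_add2l.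
apply: (@rho_transfer R k M (N * c) x x (N * (c %/ M)) pi alpha combine Q
  (fun=> predT) (fun I q => shift q @: I)).
- by move=> I _; rewrite cardT -cardE card_prod !card_ord.
- move=> I q; rewrite !inE => /andP[/eqP cI /width_leP wI] _.
  rewrite card_in_imset ?cI ?eqxx; last exact: (@strict_mono_inj _ _ (shift q) I (@smono q I)).
  apply/width_leP => _ _ /imsetP[i iI ->] /imsetP[j jI ->] /=.
  by rewrite !subnDl; apply: wI.
- move=> I q _ _; apply: is_occ_imset; first exact: smono.
  move=> i j _ _ _; rewrite combine_fine ?shift_div ?shift_moddiv //.
  by rewrite !shift_modmod !pvalE.
- move=> I q I' q'; rewrite !inE => /andP[/eqP cI _] _ _ _ E.
  (* One point of the image reveals the copy in which it lies, so [I] has to be nonempty here. *)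
  have /card_gt0P[i iI] : (0 < #|I|)%N by rewrite cI.
  have := imset_f (shift q) iI; rewrite E => /imsetP[i' i'I' ii'].
  have qq' : q = q'.
    rewrite [q]surjective_pairing [q']surjective_pairing; congr pair; apply: val_inj => /=.
      by rewrite -(shift_div q i) ii' shift_div.
    by rewrite -(shift_moddiv q i) ii' shift_moddiv.
  split=> //; subst q'; apply: imset_inj E => a b ab; apply: val_inj => /=.
  by rewrite -(shift_modmod q a) ab shift_modmod.
Qed.

End Fine.

Section Coarse.
Variables (k a x : nat) (pi : 'S_k).
Hypothesis acx : (a * c <= x)%N.

Let Q : finType := {ffun 'I_N -> 'I_c}.

Let place_lt (r : Q) (b : 'I_N) : (b * c + r b < N * c)%N.
Proof. by have := ltn_ord b; have := ltn_ord (r b); nia. Qed.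

Let place (r : Q) (b : 'I_N) : 'I_(N * c) := Ordinal (place_lt r b).

Let place_div r b : (place r b %/ c = b)%N.
Proof. by rewrite /= divnMDl // (divn_small (ltn_ord (r b))) addn0. Qed.

Let place_mod r b : (place r b %% c = r b)%N.
Proof. by rewrite /= modnMDl (modn_small (ltn_ord (r b))). Qed.

Let place_mono r (b b' : 'I_N) : (b < b')%N -> (place r b < place r b')%N.
Proof. by move=> bb'; rewrite /= ltn_digit // neq_ltn bb'. Qed.

(** A label chooses a position in each block of [I]. It is a function on all blocks, fixed to [y0]
    outside [I], so that one type holds the labels of every [I] and exactly [c ^ k] of them belong
    to each. The subsets missed have two points in one block or spread over more than [a] blocks. *)
Lemma rho_combine_coarse_transfer :
  `|rho (x%:R : R) pi combine - rho (a%:R : R) pi beta| <=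
  1 - (c ^ k * #|ksub N k a|)%:R / #|ksub (N * c) k x|%:R.
Proof.
pose y0 := Ordinal c0.
have smono r (I : {set 'I_N}) :
    {in I &, forall i j : 'I_N, (i < j)%N -> (place r i < place r j)%N}.
  by move=> i j _ _; apply: place_mono.
apply: (@rho_transfer R k N (N * c) a x (c ^ k) pi beta combine Q
  (fun I => pffun_on y0 I predT) (fun I r => place r @: I)).
- by move=> I; rewrite inE card_pffun_on cardT -cardE card_ord => /andP[/eqP-> _].
- move=> I r; rewrite !inE => /andP[/eqP cI /width_leP wI] _.
  rewrite card_in_imset ?cI ?eqxx; last exact: (@strict_mono_inj _ _ (place r) I (@smono r I)).
  apply/width_leP => _ _ /imsetP[i iI ->] /imsetP[j jI ->] /=.
  exact: (block_distance (ltn_ord (r i)) (ltn_ord (r j)) (wI i j iI jI) acx).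
- move=> I r _ _; apply: is_occ_imset; first exact: smono.
  move=> i j _ _ ij; rewrite combine_coarse ?place_div ?pvalE //.
  by rewrite neq_ltn ij.
- move=> I r I' r' _ /pffun_onP[/fintype.subsetP sr _] _ /pffun_onP[/fintype.subsetP sr' _] E.
  have sub (J J' : {set 'I_N}) q q' : place q @: J = place q' @: J' -> forall b, b \in J ->
      b \in J' /\ q b = q' b.
    move=> EJ b bJ; have : place q b \in place q' @: J' by rewrite -EJ imset_f.
    move=> /imsetP[b' b'J' bb'].
    have Eb : b = b' by apply: val_inj => /=; rewrite -(place_div q b) bb' place_div.
    subst b'; split=> //; apply: val_inj => /=.
    by rewrite -(place_mod q b) bb' place_mod.
  have II' : I = I'.
    apply/setP => b; apply/idP/idP => /sub H; first by have [] := H _ _ _ E.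
    by have [] := H _ _ _ (esym E).
  split=> //; apply/ffunP => b; case: (boolP (b \in I)) => bI.
    by have [] := sub _ _ _ _ E b bI.
  have -> : r b = y0 by apply/eqP/negbNE/negP => /sr; apply/negP.
  by apply/esym/eqP/negbNE/negP => /sr'; apply/negP; rewrite -II'.
Qed.

End Coarse.
End Combine.

(** * Error estimates *)

Section Estimates.
Variable R : realType.

Lemma bernoulli_le (e : R) K : 0 <= e <= 1 -> 1 - K%:R * e <= (1 - e) ^+ K.
Proof.
move=> /andP[e0 e1]; elim: K => [|K IH]; first by rewrite mul0r subr0 expr0.
have P0 : 0 <= (1 - e) ^+ K by rewrite exprn_ge0 // subr_ge0.
have P1 : (1 - e) ^+ K <= 1 by rewrite exprn_ile1 // ?subr_ge0 // gerBl.
rewrite exprS mulrBl mul1r -natr1 mulrDl mul1r.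
have : e * (1 - e) ^+ K <= e by rewrite ler_piMr.
lra.
Qed.

Lemma ffact_le_exp y K : (y ^_ K <= y ^ K)%N.
Proof.
elim: K y => [|K IH] y //; rewrite ffactnS expnS leq_mul2l.
apply/orP; right; apply: leq_trans (IH _) _.
by case: K {IH} => // K; rewrite leq_exp2r ?leq_pred.
Qed.

Lemma exp_le_ffact B K : (B ^ K <= (B + K) ^_ K)%N.
Proof.
elim: K => [|K IH] //; rewrite addnS ffactnS /= expnS leq_mul //.
by rewrite (leq_trans (leq_addr K B)).
Qed.

Lemma leq_ffact m n K : (m <= n)%N -> (m ^_ K <= n ^_ K)%N.
Proof.
elim: K m n => [|K IH] m n mn //; rewrite !ffactnS leq_mul // IH //.
by rewrite -!subn1 leq_sub2r.
Qed.

(** After multiplication by [K!] the left binomial is at most [Y ^ K] and the right one at least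
    [B ^ K]. The last hypothesis compares the bases, and Bernoulli's inequality replaces
    [(1 - e) ^ K] by [1 - K * e]. *)
Lemma bin_ratio c A y K B (Y : nat) (e : R) : (B + K <= A)%N -> (y <= Y)%N ->
  0 <= e -> (1 - e) * Y%:R <= c%:R * B%:R ->
  (1 - K%:R * e) * 'C(y, K)%:R <= c%:R ^+ K * 'C(A, K)%:R.
Proof.
move=> BA yY e0 H.
have [neg|pos] := lerP (1 - K%:R * e) 0.
  by apply: (@le_trans _ _ 0); rewrite ?mulr_le0_ge0 ?mulr_ge0 ?exprn_ge0.
have K0 : 0 < K`!%:R :> R by rewrite ltr0n fact_gt0.
rewrite -(ler_pM2r K0) -!mulrA -!natrM !bin_ffact.
have [->|Kp] := posnP K; first by rewrite mul0r subr0 expr0 !ffactn0.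
have e1 : e <= 1.
  have : 1 <= K%:R :> R by rewrite ler1n.
  move: pos; rewrite subr_gt0 => pos h.
  by apply: le_trans (ltW pos); rewrite ler_peMl.
have H1 : (1 - K%:R * e) * (y ^_ K)%:R <= (1 - e) ^+ K * Y%:R ^+ K.
  apply: ler_pM; rewrite ?(ltW pos) ?bernoulli_le ?e0 //.
  rewrite -natrX ler_nat (leq_trans (ffact_le_exp _ _)) //.
  by rewrite leq_exp2r.
apply: (le_trans H1); rewrite -exprMn.
apply: (@le_trans _ _ ((c%:R * B%:R) ^+ K)).
  by apply: lerXn2r => //; rewrite nnegrE mulr_ge0 // subr_ge0.
rewrite exprMn ler_wpM2l ?exprn_ge0 // -natrX ler_nat.
apply: (leq_trans (exp_le_ffact _ _)); exact: leq_ffact.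
Qed.

Lemma one_sub_ratio_le (S T : nat) (e : R) : (0 < T)%N ->
  (0 <= 1 - e -> (1 - e) * T%:R <= S%:R) -> 1 - S%:R / T%:R <= e.
Proof.
move=> T0 H; have TR : 0 < T%:R :> R by rewrite ltr0n.
have [h|h] := lerP 0 (1 - e).
  by rewrite lerBlDr -lerBlDl ler_pdivlMr // H.
have : 0 <= S%:R / T%:R :> R by rewrite divr_ge0.
lra.
Qed.

Section CombineEstimates.
Variables (N M c : nat) (beta : 'S_N) (alpha : 'S_M).
Hypotheses (M0 : (0 < M)%N) (c0 : (0 < c)%N) (N0 : (0 < N)%N).
Variables (k : nat) (pi : 'S_k).

(** The term [M / c] pays for the truncated copy in each block, the term [x / M] for subsets
    crossing the end of a copy. *)
Lemma rho_combine_fine x : (k <= x)%N -> (x < M)%N -> (M <= c)%N ->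
  `|rho (x%:R : R) pi (combine beta alpha M0 c0) - rho (x%:R : R) pi alpha| <=
  M%:R / c%:R + x%:R / M%:R.
Proof.
move=> kx xM Mc; have [k0|k0] := posnP k.
  by subst k; rewrite !rho_card0 subrr normr0 addr_ge0 // divr_ge0.
have x0 : (0 < x)%N by lia.
have D0 : (0 < 'C(x.-1, k.-1))%N by rewrite bin_gt0; lia.
apply: le_trans (rho_combine_fine_transfer beta alpha M0 c0 R x pi k0) _.
have lo := card_ksub_ge M k0 x0; have hi := card_ksub_le (N * c) k0 x0.
have lo2 := card_ksub_ge (N * c) k0 x0.
apply: one_sub_ratio_le.
  by apply: leq_trans lo2; rewrite muln_gt0 D0 andbT; nia.
move=> e0; apply: (@le_trans _ _ ((1 - (M%:R / c%:R + x%:R / M%:R)) * (N * c * 'C(x.-1, k.-1))%:R)).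
  by rewrite ler_wpM2l // ler_nat.
apply: (@le_trans _ _ (N * (c %/ M) * ((M - x) * 'C(x.-1, k.-1)))%:R); last first.
  by rewrite ler_nat leq_mul2l lo orbT.
have cR : 0 < c%:R :> R by rewrite ltr0n.
have MR : 0 < M%:R :> R by rewrite ltr0n.
have qM : c%:R - M%:R <= (c %/ M)%:R * M%:R :> R.
  rewrite lerBlDr -natrM -natrD ler_nat {1}(divn_eq c M) leq_add2l.
  by rewrite ltnW // ltn_pmod.
have xMR : x%:R <= M%:R :> R by rewrite ler_nat ltnW.
have -> : (1 - (M%:R / c%:R + x%:R / M%:R)) * (N * c * 'C(x.-1, k.-1))%:R =
    (N%:R * 'C(x.-1, k.-1)%:R) * (c%:R - M%:R - c%:R * (x%:R / M%:R)) :> R.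
  by rewrite !natrM; field; rewrite !gt_eqF.
rewrite !natrM (natrB _ (ltnW xM)).
have -> : N%:R * (c %/ M)%:R * ((M%:R - x%:R) * 'C(x.-1, k.-1)%:R) =
    (N%:R * 'C(x.-1, k.-1)%:R) * ((c %/ M)%:R * (M%:R - x%:R)) :> R by ring.
rewrite ler_wpM2l ?mulr_ge0 //.
have -> : (c %/ M)%:R * (M%:R - x%:R) = ((c %/ M)%:R * M%:R) * (1 - x%:R / M%:R) :> R.
  by field; rewrite gt_eqF.
have y1 : 0 <= 1 - x%:R / M%:R :> R by rewrite subr_ge0 ler_pdivrMr ?mul1r.
have y0 : 0 <= x%:R / M%:R :> R by rewrite divr_ge0.
have := ler_wpM2r y1 qM; set y := x%:R / M%:R in y0 y1 *.
have := mulr_ge0 (ltW MR) y0.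
by move: (c%:R : R) (M%:R : R) ((c %/ M)%:R * M%:R : R) => C' M' q' h1 h2; lra.
Qed.

(** The term [a / N] pays for the windows cut off at the end of [beta], the rest for passing from
    ['C(x - 1, k - 1)] to [c ^ (k - 1) * 'C(a - 1, k - 1)]. The range of [x] is what [c = x %/ a]
    gives. *)
Lemma rho_combine_coarse a x : (0 < a)%N -> (k <= a)%N -> (a < N)%N ->
  (a * c <= x)%N -> (x <= a * c.+1)%N ->
  `|rho (x%:R : R) pi (combine beta alpha M0 c0) - rho (a%:R : R) pi beta| <=
  a%:R / N%:R + k%:R * (c.+1%:R^-1 + k%:R / a%:R).
Proof.
move=> a0 ka aN acx xac; have [k0|k0] := posnP k.
  by subst k; rewrite !rho_card0 subrr normr0 mul0r addr0 divr_ge0.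
have x0 : (0 < x)%N by nia.
have D0 : (0 < 'C(a.-1, k.-1))%N by rewrite bin_gt0; lia.
have [aR NR] : 0 < a%:R :> R /\ 0 < N%:R :> R by rewrite !ltr0n.
have cR : 0 < c.+1%:R :> R by rewrite ltr0n.
apply: le_trans (rho_combine_coarse_transfer beta alpha M0 c0 R pi acx) _.
have lo := card_ksub_ge N k0 a0; have hi := card_ksub_le (N * c) k0 x0.
apply: one_sub_ratio_le.
  by apply: card_ksub_gt0 => //; nia.
set e := c.+1%:R^-1 + k%:R / a%:R; have e0 : 0 <= e by rewrite addr_ge0 ?divr_ge0 ?invr_ge0.
move=> E0; apply: (@le_trans _ _ ((1 - (a%:R / N%:R + k%:R * e)) * (N * c * 'C(x.-1, k.-1))%:R)).
  by rewrite ler_wpM2l // ler_nat.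
apply: (@le_trans _ _ (c ^ k * ((N - a) * 'C(a.-1, k.-1)))%:R); last first.
  by rewrite ler_nat leq_mul2l lo orbT.
have H : (1 - k.-1%:R * e) * 'C(x.-1, k.-1)%:R <= c%:R ^+ k.-1 * 'C(a.-1, k.-1)%:R.
  (* The choice of [e] makes [(1 - e) * a * c.+1] equal to [a * c - k * c.+1], which is at most
     [c * (a - k)]. *)
  apply: (@bin_ratio _ _ _ _ (a - k) (a * c.+1)) => //; try lia.
  rewrite /e natrM natrB // -natr1.
  have -> : (1 - ((c%:R + 1)^-1 + k%:R / a%:R)) * (a%:R * (c%:R + 1)) =
    a%:R * c%:R - k%:R * (c%:R + 1) :> R by field; rewrite natr1 !gt_eqF.
  by have : 0 <= k%:R :> R by []; lra.
have {H} := ler_wpM2l (_ : 0 <= (N%:R - a%:R) * c%:R) H.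
rewrite mulr_ge0 ?subr_ge0 ?ler_nat ?(ltnW aN) // => /(_ isT) H.
have -> : (c ^ k * ((N - a) * 'C(a.-1, k.-1)))%:R =
   (N%:R - a%:R) * c%:R * (c%:R ^+ k.-1 * 'C(a.-1, k.-1)%:R) :> R.
  by rewrite !natrM natrX (natrB _ (ltnW aN)) -{1}(prednK k0) exprS; ring.
apply: le_trans H; rewrite !natrM !mulrA ler_wpM2r //.
have -> : (1 - (a%:R / N%:R + k%:R * e)) * N%:R * c%:R =
   ((N%:R - a%:R) - N%:R * (k%:R * e)) * c%:R by field; rewrite gt_eqF.
have -> : (N%:R - a%:R) * c%:R * (1 - k.-1%:R * e) =
   ((N%:R - a%:R) - (N%:R - a%:R) * (k.-1%:R * e)) * c%:R by ring.
rewrite ler_wpM2r // lerD2l lerN2.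
apply: ler_pM; rewrite ?mulr_ge0 ?subr_ge0 ?ler_nat ?(ltnW aN) //.
  by rewrite gerBl.
by rewrite ler_wpM2r // ler_nat leq_pred.
Qed.

(** At full width no window is cut off, so only the subsets with two points in one block are
    missed. *)
Lemma rho_combine_global : (k < N)%N ->
  `|rho ((N * c)%:R : R) pi (combine beta alpha M0 c0) - rho (N%:R : R) pi beta| <=
  k%:R * k%:R / N%:R.
Proof.
move=> kN; have NR : 0 < N%:R :> R by rewrite ltr0n.
apply: le_trans (rho_combine_coarse_transfer beta alpha M0 c0 R pi (leqnn _)) _.
rewrite !card_ksub_full; apply: one_sub_ratio_le.
  by rewrite bin_gt0; nia.
move=> _; rewrite natrM natrX -mulrA.
apply: (@bin_ratio _ _ _ _ (N - k) (N * c)) => //; first lia.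
rewrite natrM (natrB _ (ltnW kN)).
by rewrite le_eqVlt; apply/orP; left; apply/eqP; field; rewrite gt_eqF.
Qed.

End CombineEstimates.
End Estimates.

(** * Patterns of finitely many weighted cells *)

Section Dint.
Variable R : realType.

(* The finite counterpart of [iint]. *)
Fixpoint dint (C : finType) (w : C -> R) (k : nat) (h : seq C -> R) : R :=
  if k is k'.+1 then \sum_c w c * dint w k' (fun s => h (c :: s)) else h [::].

Section Basic.
Variables (C : finType) (w : C -> R).
Hypothesis w0 : forall c, 0 <= w c.

Lemma dint_le k (h h' : seq C -> R) : (forall s, size s = k -> h s <= h' s) ->
  dint w k h <= dint w k h'.
Proof.
elim: k h h' => [|k IH] h h' hh' /=; first exact: hh'.
by apply: ler_sum => c _; rewrite ler_wpM2l // IH // => s sk; rewrite hh' //= sk.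
Qed.

Lemma dintD k (h h' : seq C -> R) :
  dint w k (fun s => h s + h' s) = dint w k h + dint w k h'.
Proof.
elim: k h h' => [|k IH] h h' //=.
by rewrite -big_split /=; apply: eq_bigr => c _; rewrite IH mulrDr.
Qed.

Lemma dint_ge0 k (h : seq C -> R) : (forall s, 0 <= h s) -> 0 <= dint w k h.
Proof.
elim: k h => [|k IH] h h0 //=; apply: sumr_ge0 => c _.
by rewrite mulr_ge0 // IH.
Qed.

Hypothesis w1 : \sum_c w c = 1.

Lemma dint_cst k (a : R) : dint w k (fun=> a) = a.
Proof. by elim: k => //= k IH; rewrite IH -mulr_suml w1 mul1r. Qed.

Lemma dint_le1 k (h : seq C -> R) : (forall s, h s <= 1) -> dint w k h <= 1.
Proof. by move=> h1; rewrite -(dint_cst k 1); apply: dint_le => s _. Qed.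

Lemma dint_has k (P : pred C) :
  dint w k (fun s => (has P s)%:R) <= k%:R * \sum_(c | P c) w c.
Proof.
have P0 : 0 <= \sum_(c | P c) w c by apply: sumr_ge0.
elim: k => [|k IH] /=; first by rewrite mul0r.
apply: (@le_trans _ _ (\sum_c w c * ((P c)%:R + k%:R * \sum_(c | P c) w c))).
  apply: ler_sum => c _; rewrite ler_wpM2l //.
  apply: le_trans (_ : dint w k (fun s => (P c)%:R + (has P s)%:R) <= _).
    by apply: dint_le => s _; case: (P c) => //=; case: (has P s); rewrite ?add0r ?lerDl.
  by rewrite dintD dint_cst lerD2l.
rewrite (eq_bigr (fun c => w c * (P c)%:R + w c * (k%:R * \sum_(c | P c) w c))); last first.
  by move=> c _; rewrite mulrDr.
rewrite big_split /= -mulr_suml w1 mul1r -natr1 mulrDl mul1r addrC lerD2l.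
rewrite [leRHS]big_mkcond /=; apply: ler_sum => c _.
by case: (P c); rewrite ?mulr1 ?mulr0.
Qed.

(** A union bound over pairs: a new cell conflicts with one of [k] others with probability at most
    [k * b], and [k + k ^ 2 <= (k + 1) ^ 2]. *)
Lemma dint_pairwise (share : rel C) (b : R) k :
  (forall c, \sum_(c' | share c c') w c' <= b) ->
  dint w k (fun s => (~~ pairwise (fun c c' => ~~ share c c') s)%:R) <= k%:R * k%:R * b.
Proof.
(* Any cell shows that [b] is nonnegative; without cells the weights could not sum to 1. *)
move=> Hb; have b0 : 0 <= b \/ forall c : C, False.
  have [c _|C0] := pickP (mem C); last by right=> c; have := C0 c.
  by left; apply: le_trans (Hb c); apply: sumr_ge0.
elim: k => [|k IH]; first by rewrite /= !mul0r.
rewrite /=; apply: (@le_trans _ _ (\sum_c w c * (k%:R * b + k%:R * k%:R * b))).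
  apply: ler_sum => c _; rewrite ler_wpM2l //.
  apply: le_trans (_ : dint w k (fun s => (has (share c) s)%:R +
     (~~ pairwise (fun c c' => ~~ share c c') s)%:R) <= _).
    apply: dint_le => s _; rewrite negb_and -has_predC.
    rewrite (@eq_has _ _ (share c)); last by move=> x /=; rewrite negbK.
    by case: (has _ _); case: (pairwise _ _) => /=; rewrite ?add0r ?lerDl ?addr0.
  rewrite dintD lerD //; apply: (le_trans (dint_has _ _)).
  by rewrite ler_wpM2l.
rewrite -mulr_suml w1 mul1r.
case: b0 => [b0|C0]; last first.
  by move: w1; rewrite big1 => [/eqP|c]; [rewrite eq_sym oner_eq0|have := C0 c].
rewrite -mulrDl ler_wpM2r // -!natrM -natrD ler_nat; nia.
Qed.

End Basic.

(** The weights are exchanged one coordinate at a time. As [h] takes values in [[0,1]], each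
    exchange costs at most the l1 distance of the weights. *)
Lemma dint_lipschitz (C : finType) (w w' : C -> R) k (h : seq C -> R) :
  (forall c, 0 <= w c) -> (forall c, 0 <= w' c) ->
  \sum_c w c = 1 -> \sum_c w' c = 1 -> (forall s, 0 <= h s <= 1) ->
  `|dint w k h - dint w' k h| <= k%:R * \sum_c `|w c - w' c|.
Proof.
move=> w0 w'0 w1 w'1; elim: k h => [|k IH] h h01 /=.
  by rewrite subrr normr0 mul0r.
set e := \sum_c _ in IH *.
rewrite -sumrB (eq_bigr (fun c => (w c - w' c) * dint w k (fun s => h (c :: s)) +
  w' c * (dint w k (fun s => h (c :: s)) - dint w' k (fun s => h (c :: s))))); last first.
  by move=> c _; ring.
rewrite big_split /=; apply: le_trans (ler_normD _ _) _.
rewrite -natr1 mulrDl mul1r addrC lerD //.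
  apply: le_trans (ler_norm_sum _ _ _) _.
  apply: (@le_trans _ _ (\sum_c w' c * (k%:R * e))).
    apply: ler_sum => c _; rewrite normrM (ger0_norm (w'0 c)) ler_wpM2l // IH //.
  by rewrite -mulr_suml w'1 mul1r.
apply: le_trans (ler_norm_sum _ _ _) _; apply: ler_sum => c _.
rewrite normrM ler_piMr // ger0_norm.
  by apply: dint_le1 => // s; case/andP: (h01 (c :: s)).
by apply: dint_ge0 => // s; case/andP: (h01 (c :: s)).
Qed.

Lemma dint_map (P C : finType) (phi : P -> C) (w : P -> R) k (h : seq C -> R) :
  dint w k (fun s => h (map phi s)) = dint (fun c => \sum_(p | phi p == c) w p) k h.
Proof.
elim: k h => [|k IH] h //=.
rewrite (partition_big phi xpredT) //=; apply: eq_bigr => c _.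
rewrite mulr_suml; apply: eq_bigr => p /eqP pc.
by rewrite (IH (fun s => h (phi p :: s))) pc.
Qed.

Lemma dint_tuple (C : finType) (a : R) k (h : seq C -> R) :
  dint (fun=> a) k h = a ^+ k * \sum_(t : k.-tuple C) h t.
Proof.
elim: k h => [|k IH] h /=.
  rewrite expr0 mul1r (big_pred1 [tuple]) // => t.
  by apply/esym/eqP; exact: tuple0.
rewrite (eq_bigr (fun c => a ^+ k.+1 * \sum_(t : k.-tuple C) h (c :: t))); last first.
  by move=> c _; rewrite IH exprS mulrA.
rewrite -mulr_sumr; congr (_ * _); rewrite pair_big /=.
rewrite [RHS](reindex (fun p : C * k.-tuple C => [tuple of p.1 :: p.2])) //=.
exists (fun t : k.+1.-tuple C => (thead t, [tuple of behead t])) => [[c t] _|t _] /=.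
  by congr pair; apply: val_inj.
by rewrite [RHS]tuple_eta.
Qed.

End Dint.

Lemma card_classical_set (T : finType) (P : pred T) :
  #|[set j | P j]%classic| = #|[set j | P j]|.
Proof. by apply: eq_card => j; rewrite [RHS]inE; exact: asboolb. Qed.

(** * Pattern events of points in cells and of entries of a permutation *)

Section PatEvent.
Variable R : realType.
Implicit Types s : seq (R * R).

Lemma pat_event_congr k (pi : 'S_k) s s' :
  (forall i j : 'I_k, ((nth (0, 0) s i).1 < (nth (0, 0) s j).1) =
                      ((nth (0, 0) s' i).1 < (nth (0, 0) s' j).1)) ->
  (forall i j : 'I_k, ((nth (0, 0) s i).2 < (nth (0, 0) s j).2) =
                      ((nth (0, 0) s' i).2 < (nth (0, 0) s' j).2)) ->
  pat_event pi s = pat_event pi s'.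
Proof.
move=> H1 H2; rewrite /pat_event /=.
have rE (i : 'I_k) :
    #|[set j : 'I_k | (nth (0, 0) s (val j)).1 < (nth (0, 0) s (val i)).1]%classic| =
    #|[set j : 'I_k | (nth (0, 0) s' (val j)).1 < (nth (0, 0) s' (val i)).1]%classic|.
  by rewrite !card_classical_set; apply: eq_card => l; rewrite !inE H1.
apply: eq_forallb => i; apply: eq_forallb => j.
by rewrite !rE !neq_lt !H1 !H2.
Qed.

(** The condition under which the cells alone decide the order of the points in both coordinates. *)
Definition separated (C : eqType) (D : eqType) (s : seq (C * D)) : bool :=
  pairwise (fun c c' => ~~ ((c.1 == c'.1) || (c.2 == c'.2))) s.

Definition cell_point n (c : 'I_n * 'I_n) : R * R := (c.1%:R, c.2%:R).

(** In separated cells the points are ordered as their columns and rows are. The type [X] is general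
    in order to serve for points of the plane and for entries of a permutation. *)
Lemma pat_event_cells (X : Type) n k (pi : 'S_k) (pt : X -> R * R) (phi : X -> 'I_n * 'I_n)
    (s : seq X) :
  (forall p q, ((phi p).1 < (phi q).1)%N -> (pt p).1 < (pt q).1) ->
  (forall p q, ((phi p).2 < (phi q).2)%N -> (pt p).2 < (pt q).2) ->
  size s = k -> separated (map phi s) ->
  pat_event pi (map pt s) = pat_event pi (map (@cell_point n) (map phi s)).
Proof.
move=> H1 H2 sk sep.
case: s sk sep => [|x0 s'].
  by move=> k0 _.
set s := x0 :: s' => sk sep.
have key (i j : 'I_k) : i != j ->
    ((phi (nth x0 s i)).1 != (phi (nth x0 s j)).1) /\
    ((phi (nth x0 s i)).2 != (phi (nth x0 s j)).2).
  move=> ij; move: sep; rewrite /separated pairwise_map => /(pairwiseP x0) sep.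
  have [h|h|/val_inj h] := ltngtP i j; last by rewrite h eqxx in ij.
    have := sep i j; rewrite !inE sk !ltn_ord h => /(_ isT isT isT) /=.
    by rewrite negb_or => /andP.
  have := sep j i; rewrite !inE sk !ltn_ord h => /(_ isT isT isT) /=.
  by rewrite negb_or => /andP[a b]; split; rewrite eq_sym.
have nthE (f : X -> R * R) (i : 'I_k) : nth (0, 0) (map f s) i = f (nth x0 s i).
  by rewrite (nth_map x0) // sk.
rewrite -map_comp; apply: pat_event_congr => i j; rewrite !nthE /= ltr_nat;
  (have [->|/key[n1 n2]] := eqVneq i j; first by rewrite ltxx ltnn).
  move: n1; rewrite -val_eqE /=; case: ltngtP => // [/H1->//|/H1/ltW] h _.
  by rewrite ltNge h.
move: n2; rewrite -val_eqE /=; case: ltngtP => // [/H2->//|/H2/ltW] h _.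
by rewrite ltNge h.
Qed.

Definition perm_point N (sigma : 'S_N) (i : 'I_N) : R * R := (i%:R, (sigma i)%:R).

(** The condition [uniq t] matches the demand for distinct x-coordinates. Given it, counting tuple
    entries to the left of a point gives its rank in the underlying set. *)
Lemma pat_event_perm N (sigma : 'S_N) k (pi : 'S_k) (t : k.-tuple 'I_N) :
  pat_event pi (map (perm_point sigma) t) = uniq t && is_occ pi sigma [set x in t].
Proof.
have nthE (i : 'I_k) : nth (0, 0) (map (perm_point sigma) t) i = perm_point sigma (tnth t i).
  by rewrite (nth_map (tnth t i)) ?size_tuple // -tnth_nth.
have uE : uniq t = [forall i : 'I_k, forall j : 'I_k, (i != j) ==> (tnth t i != tnth t j)].
  apply/tuple_uniqP/'forall_'forall_implyP => [inj i j|H i j /eqP].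
    by apply: contraNN => /eqP/inj/eqP.
  by apply: contraTeq => ij; apply: H.
case: (boolP (uniq t)) => [ut|nut] /=; last first.
  apply/negbTE; move: nut; rewrite uE; apply: contraNN => /'forall_forallP H.
  apply/'forall_forallP => i j; have := H i j; rewrite !nthE /= eqr_nat.
  by case/andP.
have tinj : injective (tnth t) by exact/tuple_uniqP.
have cardI : #|[set x in t]| = k.
  by rewrite cardsE (card_uniqP ut) size_tuple.
have rkE (i : 'I_k) : #|[set j : 'I_k | (nth (0, 0) (map (perm_point sigma) t) (val j)).1 <
     (nth (0, 0) (map (perm_point sigma) t) (val i)).1]%classic| =
     rk [set x in t] (tnth t i).
  rewrite /rk.
  have -> : [set j in [set x in t] | (j < tnth t i)%N] =
     tnth t @: [set j | (tnth t j < tnth t i)%N].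
    apply/setP => j; rewrite !inE; apply/andP/imsetP => [[/tnthP[l ->] li]|[l]].
      by exists l; rewrite ?inE.
    by rewrite inE => li ->; rewrite mem_tnth.
  rewrite card_imset // card_classical_set; apply: eq_card => j.
  by rewrite !inE !nthE /= ltr_nat.
rewrite /is_occ cardI eqxx /=; apply/'forall_forallP/'forall_implyP => H.
  move=> x; rewrite inE => /tnthP[i ->]; apply/'forall_implyP => y.
  rewrite inE => /tnthP[j ->]; apply/implyP => ij.
  have := H i j => /andP[_ /implyP]; rewrite !rkE !nthE /= !ltr_nat; exact.
move=> i j; rewrite !rkE !nthE /= !ltr_nat eqr_nat; apply/andP; split.
  by apply/implyP; apply: contraNN => /eqP/val_inj/tinj/eqP.
have ti : tnth t i \in [set x in t] by rewrite inE mem_tnth.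
have tj : tnth t j \in [set x in t] by rewrite inE mem_tnth.
have := H _ ti => /'forall_implyP /(_ _ tj); exact.
Qed.

Lemma card_tuples_of_set (T : finType) k (I : {set T}) : #|I| = k ->
  #|[set t : k.-tuple T | uniq t && ([set x in t] == I)]| = k`!.
Proof.
move=> cI; transitivity (#|I| ^_ k)%N; last by rewrite cI ffactnn.
rewrite -card_uniq_tuples; apply: eq_card => t.
rewrite !inE andbC; apply/andP/andP => [[/eqP EI ut]|[aI ut]]; split => //.
  by apply/allP => x xt; suff : x \in I by []; rewrite -EI inE.
rewrite eqEcard cI cardsE (card_uniqP ut) size_tuple leqnn andbT.
by apply/fintype.subsetP => x; rewrite inE => /(allP aI).
Qed.

(** Among the [N ^ k] tuples drawn with replacement, each occurrence is listed exactly [k!]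
    times. *)
Lemma dint_perm N (sigma : 'S_N) k (pi : 'S_k) :
  dint (fun=> N%:R^-1) k (fun s : seq 'I_N => (pat_event pi (map (perm_point sigma) s))%:R) =
  (#|occs pi sigma N| * k`!)%:R / N%:R ^+ k :> R.
Proof.
rewrite dint_tuple mulrC -exprVn; congr (_ * _).
rewrite -natr_sum; congr _%:R.
rewrite (eq_bigr (fun t : k.-tuple 'I_N =>
  (uniq t && is_occ pi sigma [set x in t] : nat))); last first.
  by move=> t _; rewrite pat_event_perm.
rewrite -big_mkcond /= -sum_nat_const.
rewrite (partition_big (fun t : k.-tuple 'I_N => [set x in t])
  (mem (occs pi sigma N))) /=; last first.
  move=> t /andP[ut oI]; rewrite inE oI /=; apply/width_leP => i j _ _.
  by apply: leq_ltn_trans (ltn_ord j); apply: leq_subr.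
apply: eq_bigr => I; rewrite inE => /andP[oI wI].
rewrite -(@card_tuples_of_set _ k I); last by case/andP: oI => /eqP.
rewrite -sum1_card; apply: eq_bigl => t; rewrite inE.
by case: eqP => [->|]; rewrite ?oI ?andbT ?andbF.
Qed.

(** Sampling with replacement differs from sampling without by the factor [N ^_ k / N ^ k], the
    probability that all draws are distinct, which is at least [1 - k ^ 2 / N]. *)
Lemma dint_perm_rho N (sigma : 'S_N) k (pi : 'S_k) : (k < N)%N ->
  `|dint (fun=> N%:R^-1) k (fun s : seq 'I_N => (pat_event pi (map (perm_point sigma) s))%:R) -
    rho (N%:R : R) pi sigma| <= k%:R * k%:R / N%:R.
Proof.
move=> kN; have NR : 0 < N%:R :> R by rewrite ltr0n; lia.
rewrite dint_perm; set D := _ / _.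
have C0 : 0 < 'C(N, k)%:R :> R by rewrite ltr0n bin_gt0 ltnW.
have NK0 : 0 < N%:R ^+ k :> R by rewrite exprn_gt0.
have r1 := rho_le1 R pi sigma N; have r0 := rho_ge0 pi sigma (N%:R : R).
set e := k%:R * k%:R / N%:R.
have [q0 q1 DE] : [/\ 1 - e <= (N ^_ k)%:R / N%:R ^+ k, (N ^_ k)%:R / N%:R ^+ k <= 1 :> R &
    D = rho (N%:R : R) pi sigma * ((N ^_ k)%:R / N%:R ^+ k)].
  split.
  - rewrite ler_pdivlMr // (le_trans (_ : _ <= (N - k)%:R ^+ k)) //; last first.
      by rewrite -natrX ler_nat -{2}(subnK (ltnW kN)) exp_le_ffact.
    have [e1|e1] := lerP 0 (1 - k%:R / N%:R : R); last first.
      by move: e1; rewrite subr_lt0 ltr_pdivlMr // mul1r ltr_nat; lia.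
    have -> : (N - k)%:R = (1 - k%:R / N%:R) * N%:R :> R.
      by rewrite (natrB _ (ltnW kN)); field; rewrite gt_eqF.
    rewrite exprMn ler_wpM2r ?exprn_ge0 // /e -mulrA bernoulli_le //.
    by rewrite divr_ge0 //= -subr_ge0.
  - by rewrite ler_pdivrMr // mul1r -natrX ler_nat ffact_le_exp.
  - rewrite rhoE card_ksub_full -bin_ffact /D !natrM; field.
    by rewrite !gt_eqF.
rewrite DE; set q := _ / _ in q0 q1 *; set r := rho _ _ _ in r0 r1 *.
have e0 : 0 <= e by rewrite divr_ge0 // mulr_ge0.
by rewrite ler_norml; apply/andP; split; nra.
Qed.

End PatEvent.

(** * Cell masses of a permuton *)

Section Integral.
Context d (T : measurableType d) (R : realType).
Variable mu : {measure set T -> \bar R}.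

(* The integral of a nonnegative function is a supremum over simple functions,
   so monotonicity needs no measurability. *)
Lemma le_integral_ge0 (f g : T -> \bar R) : (forall x, 0 <= f x)%E ->
  (forall x, f x <= g x)%E -> (\int[mu]_x f x <= \int[mu]_x g x)%E.
Proof.
move=> f0 fg; have g0 x : (0 <= g x)%E := le_trans (f0 x) (fg x).
rewrite !ge0_integralE // !patch_setT.
apply: ge_ereal_sup => _ [h /= hf <-]; apply: ereal_sup_ubound; exists h => //= x.
exact: le_trans (hf x) _.
Qed.

Lemma integral_finite_comp (C : finType) (phi : T -> C) (w h : C -> R) :
  (forall c, measurable (phi @^-1` [set c])%classic) ->
  (forall c, mu (phi @^-1` [set c])%classic = (w c)%:E) ->
  (forall c, 0 <= h c) ->
  (\int[mu]_x (h (phi x))%:E = (\sum_c w c * h c)%:E)%E.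
Proof.
move=> mphi wE h0.
transitivity (\int[mu]_x (\sum_(c <- index_enum C)
    ((h c)%:E * (\1_(phi @^-1` [set c])%classic x)%:E)))%E.
  apply: eq_integral => x _; under eq_bigr do rewrite -EFinM.
  rewrite sumEFin; congr EFin.
  rewrite (bigD1 (phi x)) //= indicE mem_set // mulr1 big1 ?addr0 // => c cx.
  by rewrite indicE memNset ?mulr0 //= => /esym/eqP; apply/negP.
rewrite ge0_integral_sum //.
- rewrite -sumEFin; apply: eq_bigr => c _.
  rewrite ge0_integralZl_EFin //.
  + by rewrite integral_indic // setIT wE EFinM muleC.
  + by apply/measurable_EFinP; exact: measurable_indic.
- move=> c; apply: measurable_funeM.
  by apply/measurable_EFinP; exact: measurable_indic.
- by move=> c x _; rewrite mule_ge0 // lee_fin.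
Qed.

End Integral.

Section Iint.
Variables (R : realType) (G : {measure set (R * R)%type -> \bar R}).

Lemma iint_ge0 k (F : seq (R * R) -> \bar R) :
  (forall s, size s = k -> 0 <= F s)%E -> (0 <= iint G k F)%E.
Proof.
elim: k F => [|k IH] F F0 /=; first exact: F0.
by apply: integral_ge0 => p _; apply: IH => s sk; apply: F0; rewrite /= sk.
Qed.

(** By [le_integral_ge0] this applies to the pattern event as it stands, which can thus be squeezed
    between functions of the cells. *)
Lemma le_iint k (F F' : seq (R * R) -> \bar R) :
  (forall s, size s = k -> 0 <= F s)%E -> (forall s, size s = k -> F s <= F' s)%E ->
  (iint G k F <= iint G k F')%E.
Proof.
elim: k F F' => [|k IH] F F' F0 FF' /=; first exact: FF'.
apply: le_integral_ge0 => p.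
  by apply: iint_ge0 => s sk; apply: F0; rewrite /= sk.
by apply: IH => s sk; [apply: F0 | apply: FF']; rewrite /= sk.
Qed.

Lemma iint_finite_comp (C : finType) (phi : R * R -> C) (w : C -> R) k (h : seq C -> R) :
  (forall c, 0 <= w c) ->
  (forall c, measurable (phi @^-1` [set c])%classic) ->
  (forall c, G (phi @^-1` [set c])%classic = (w c)%:E) ->
  (forall s, 0 <= h s) ->
  iint G k (fun s => (h (map phi s))%:E) = (dint w k h)%:E.
Proof.
move=> w0 mphi wE; elim: k h => [|k IH] h h0 //=.
rewrite -(integral_finite_comp (mu := G) mphi wE); last by move=> c; apply: dint_ge0.
by apply: eq_integral => p _; rewrite (IH (fun s => h (phi p :: s))).
Qed.

End Iint.

Section Grid.
Variables (R : realType) (G : {measure set (R * R)%type -> \bar R}).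
Hypothesis GP : permuton G.
Variable n : nat.
Hypothesis n0 : (0 < n)%N.

(** Strips of width [1 / n]. The additional index [n] collects all [x >= 1], and negative [x] go to
    strip 0, so the map is total and monotone on the line. *)
Definition column (x : R) : 'I_n.+1 := inord (minn n (Num.truncn (n%:R * x))).

Lemma columnE x : column x = minn n (Num.truncn (n%:R * x)) :> nat.
Proof. by rewrite inordK // ltnS geq_minl. Qed.

Lemma column_le x y : x <= y -> (column x <= column y)%N.
Proof.
move=> xy; rewrite !columnE leq_min geq_minl /= geq_min; apply/orP; right.
by apply: le_truncn; rewrite ler_wpM2l.
Qed.

Lemma column_lt x y : (column x < column y)%N -> x < y.
Proof. by rewrite ltNge; apply: contraTN => /column_le; rewrite -leqNgt. Qed.

Lemma measurable_column i : measurable (column @^-1` [set i])%classic.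
Proof.
apply: is_interval_measurable => x y /= xi yi z /andP[xz zy].
apply: val_inj; apply/eqP; rewrite eqn_leq.
by rewrite -{1}yi -xi !column_le.
Qed.

Definition cell (p : R * R) : 'I_n.+1 * 'I_n.+1 := (column p.1, column p.2).

Lemma cell_preimage c : (cell @^-1` [set c] =
  (column @^-1` [set c.1]) `*` (column @^-1` [set c.2]))%classic.
Proof.
by apply/seteqP; split => -[x y] /=; [move=> <-|case=> hx hy; case: c hx hy => a b /= <- <-].
Qed.

Lemma measurable_cell c : measurable (cell @^-1` [set c])%classic.
Proof. by rewrite cell_preimage; apply: measurableX; exact: measurable_column. Qed.

Lemma permuton_total : G setT = 1%E.
Proof.
have [+ _] := GP (measurableT : measurable [set: R]%classic).
rewrite setXTT => ->; rewrite setTI.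
have -> : [set x : R | 0 <= x <= 1]%classic = `[0%R, 1%R]%classic.
  by apply/seteqP; split => x /=; rewrite in_itv.
by rewrite lebesgue_measure_itv /= lte_fin ltr01 sube0.
Qed.

(** By the uniform marginals both masses are the length of the part of the strip in [[0,1]], which
    lies between [i / n] and [(i + 1) / n]. *)
Lemma permuton_strip i :
  (G ((column @^-1` [set i]) `*` setT)%classic <= (n%:R^-1)%:E)%E /\
  (G (setT `*` (column @^-1` [set i]))%classic <= (n%:R^-1)%:E)%E.
Proof.
have [-> ->] := GP (measurable_column i).
suff H : (lebesgue_measure ((column @^-1` [set i]) `&` [set x : R | (0 <= x <= 1)%R])%classic
   <= (n%:R^-1 : R)%:E)%E by [].
have nR : 0 < n%:R :> R by rewrite ltr0n.
have I01 : measurable [set x : R | 0 <= x <= 1]%classic.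
  apply: is_interval_measurable => x y /= /andP[x0 _] /andP[_ y1] z /andP[xz zy].
  by apply/andP; split; lra.
apply: (@le_trans _ _ (lebesgue_measure (`[(i%:R / n%:R : R), (i.+1%:R / n%:R)]%classic : set R))).
  apply: le_measure; rewrite ?inE.
  - by apply: measurableI => //; exact: measurable_column.
  - exact: measurable_itv.
  move=> x [/= xi /andP[x0 x1]]; rewrite in_itv /=.
  have nx0 : 0 <= n%:R * x by rewrite mulr_ge0.
  have := truncn_itv nx0.
  have tn : (Num.truncn (n%:R * x) <= n)%N.
    by rewrite truncn_le_nat (le_lt_trans (_ : _ <= n%:R)) ?ltr_nat // ler_piMr.
  have -> : Num.truncn (n%:R * x) = i by rewrite -xi columnE (minn_idPr tn).
  rewrite ler_pdivrMr // ler_pdivlMr // mulrC => /andP[-> /ltW ->] //.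
rewrite lebesgue_measure_itv /= lte_fin ltr_pM2r ?invr_gt0 // ltr_nat ltnSn.
by rewrite -EFinB lee_fin -mulrBl -natr1 addrAC subrr add0r mul1r.
Qed.

Definition cell_mass c : R := fine (G (cell @^-1` [set c])%classic).

Lemma cell_massE c : G (cell @^-1` [set c])%classic = (cell_mass c)%:E.
Proof.
rewrite /cell_mass fineK // ge0_fin_numE //.
apply: (@le_lt_trans _ _ (G setT)); last by rewrite permuton_total ltry.
by apply: le_measure; rewrite ?inE //; exact: measurable_cell.
Qed.

Lemma cell_mass_ge0 c : 0 <= cell_mass c.
Proof. by rewrite fine_ge0. Qed.

Lemma cell_mass_sum (P : pred ('I_n.+1 * 'I_n.+1)) (A : set (R * R)) :
  measurable A -> (forall p, A p <-> P (cell p)) ->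
  G A = (\sum_(c | P c) cell_mass c)%:E.
Proof.
move=> mA AP; rewrite -[A in LHS]setIT -integral_indic //.
transitivity (\int[G]_p (((P (cell p))%:R : R)%:E))%E.
  apply: eq_integral => p _; rewrite indicE; congr ((_ : bool)%:R%:E).
  by apply/idP/idP; rewrite inE => /AP.
rewrite (integral_finite_comp (h := fun c => (P c)%:R) measurable_cell cell_massE) //.
congr EFin; rewrite [RHS]big_mkcond /=; apply: eq_bigr => c _.
by case: (P c); rewrite ?mulr1 ?mulr0.
Qed.

Lemma cell_mass_total : \sum_c cell_mass c = 1.
Proof.
apply: EFin_inj; rewrite -(@cell_mass_sum xpredT setT) //.
exact: permuton_total.
Qed.

(** The cells in question fill one vertical and one horizontal strip, each of mass at most
    [1 / n]. *)
Lemma cell_mass_share c :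
  \sum_(c' | (c.1 == c'.1) || (c.2 == c'.2)) cell_mass c' <= 2 / n%:R.
Proof.
have [h1 _] := permuton_strip c.1; have [_ h2] := permuton_strip c.2.
have m1 : measurable ((column @^-1` [set c.1]) `*` [set: R])%classic.
  by apply: measurableX => //; exact: measurable_column.
have m2 : measurable ([set: R] `*` (column @^-1` [set c.2]))%classic.
  by apply: measurableX => //; exact: measurable_column.
rewrite (@cell_mass_sum (fun c' => c.1 == c'.1) _ m1) in h1; last first.
  by move=> p /=; split=> [[-> _]|/eqP->].
rewrite (@cell_mass_sum (fun c' => c.2 == c'.2) _ m2) in h2; last first.
  by move=> p /=; split=> [[_ ->]|/eqP->].
rewrite !lee_fin in h1 h2.
have -> : 2 / n%:R = n%:R^-1 + n%:R^-1 :> R by rewrite mulrDl mul1r.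
apply: le_trans (lerD h1 h2).
rewrite big_mkcond [X in _ <= X + _]big_mkcond [X in _ <= _ + X]big_mkcond -big_split /=.
apply: ler_sum => c' _; have := cell_mass_ge0 c'.
by case: (c.1 == _); case: (c.2 == _) => //= h; rewrite ?addr0 ?add0r ?lerDl.
Qed.

(** Separated cells decide the pattern, and otherwise the event is only known to be 0 or 1. So it
    lies between [A] and [A + B], both functions of the cells, and [dint_pairwise] bounds the
    integral of [B]. *)
Lemma rho_permuton_cells k (pi : 'S_k) :
  `|rho_permuton G pi -
    dint cell_mass k (fun s => (pat_event pi (map (@cell_point R n.+1) s) && separated s)%:R)| <=
  k%:R * k%:R * (2 / n%:R).
Proof.
set A := fun s : seq _ => (_ && separated s)%:R : R.
pose B := fun s : seq ('I_n.+1 * 'I_n.+1) => (~~ separated s)%:R : R.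
have Bk : dint cell_mass k B <= k%:R * k%:R * (2 / n%:R).
  apply: dint_pairwise => [c||c]; first exact: cell_mass_ge0.
    exact: cell_mass_total.
  exact: cell_mass_share.
have A0 s : 0 <= A s by rewrite /A.
have B0 s : 0 <= B s by rewrite /B.
have sandwich (s : seq (R * R)) : size s = k ->
    A (map cell s) <= (pat_event pi s)%:R <= A (map cell s) + B (map cell s).
  move=> sk; rewrite /A /B; case: (boolP (separated _)) => sep /=.
    rewrite -(@pat_event_cells R _ _ _ pi id cell s) ?map_id //; try by move=> p q /column_lt.
    by rewrite andbT addr0 lexx.
  by rewrite andbF add0r; case: pat_event; rewrite ?lexx ?ler01.
set F := fun s : seq (R * R) => ((pat_event pi s : nat)%:R : R)%:E.
have lo : ((dint cell_mass k A)%:E <= iint G k F)%E.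
  rewrite -(iint_finite_comp k cell_mass_ge0 measurable_cell cell_massE A0).
  apply: le_iint => s sk; rewrite lee_fin //.
  by have /andP[] := sandwich s sk.
have hi : (iint G k F <= (dint cell_mass k A + dint cell_mass k B)%:E)%E.
  rewrite -dintD.
  rewrite -(iint_finite_comp k cell_mass_ge0 measurable_cell cell_massE); last first.
    by move=> s; rewrite addr_ge0.
  apply: le_iint => s sk; rewrite lee_fin //.
  by have /andP[] := sandwich s sk.
(* [rho_permuton] is defined through [fine], so finiteness is required before passing to real
   numbers. *)
have Ff : iint G k F \is a fin_num.
  rewrite ge0_fin_numE; first exact: le_lt_trans hi (ltry _).
  by apply: iint_ge0 => s _; rewrite lee_fin.
rewrite /rho_permuton -/F; move: lo hi; rewrite -(fineK Ff) !lee_fin => lo hi.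
by rewrite ger0_norm; lra.
Qed.

End Grid.

(** * Approximating a permuton by permutations *)

(** List the cells by column with their multiplicities; the positions in this list are the indices.
    Values are ordered by row, with ties broken by position. *)
Lemma perm_of_cell_counts n (m : 'I_n * 'I_n -> nat) :
  exists (N : nat) (sigma : 'S_N) (phi : 'I_N -> 'I_n * 'I_n),
  [/\ forall c, #|[set i | phi i == c]| = m c,
      N = (\sum_c m c)%N,
      forall p q : 'I_N, ((phi p).1 < (phi q).1)%N -> (p < q)%N &
      forall p q : 'I_N, ((phi p).2 < (phi q).2)%N -> (sigma p < sigma q)%N].
Proof.
pose leT := fun c c' : 'I_n * 'I_n => (c.1 <= c'.1)%N.
pose s0 := flatten [seq nseq (m c) c | c <- enum {: 'I_n * 'I_n}].
pose s := sort leT s0; pose phi := tnth (in_tuple s).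
have cnt c : #|[set i | phi i == c]| = m c.
  rewrite -sum1_card; transitivity (\sum_(x <- s | x == c) 1)%N.
    by rewrite [RHS]big_tnth; apply: eq_bigl => i; rewrite inE.
  rewrite sum1_count (seq.permP (permEl (perm_sort leT s0))) count_flatten -map_comp.
  rewrite sumnE big_map big_enum /= (bigD1 c) //= count_nseq eqxx mul1n.
  rewrite big1 ?addn0 // => c' c'c.
  by rewrite count_nseq /= (negbTE c'c).
have key_inj : injective (fun i : 'I_(size s) => (phi i).2 * size s + i)%N.
  move=> i j E; apply: val_inj => /=.
  have := congr1 (fun z => z %% size s)%N E.
  by rewrite !modnMDl !modn_small.
have [sigma sigmaE] := perm_of_key key_inj.
exists (size s), sigma, phi; split=> //.
- rewrite -[LHS]card_ord -sum1_card (partition_big phi xpredT) //=.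
  by apply: eq_bigr => c _; rewrite -cnt -sum1_card; apply: eq_bigl => i; rewrite inE.
- move=> p q pq; rewrite ltnNge; apply/negP => qp; move: pq; apply/negP; rewrite -leqNgt.
  have x0 := phi p; rewrite /phi !(tnth_nth x0) /=.
  apply: (@sorted_leq_nth _ leT) => //; try exact: ltn_ord.
  + by move=> a b c; exact: leq_trans.
  + by move=> a; rewrite /leT leqnn.
  + by apply: sort_sorted => a b; exact: leq_total.
- move=> p q pq; rewrite sigmaE ltn_digit //.
  by rewrite neq_ltn pq.
Qed.

Section PermutonApproximation.
Variables (R : realType) (G : {measure set (R * R)%type -> \bar R}).
Hypothesis GP : permuton G.

Lemma nat_above (x : R) : exists n : nat, forall m, (n <= m)%N -> x <= m%:R.
Proof.
exists (Num.truncn x).+1 => m nm; apply: (le_trans (ltW (truncnS_gt x))).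
by rewrite ler_nat.
Qed.

Lemma nat_above_ratio (a e : R) : 0 < e ->
  exists n : nat, (0 < n)%N /\ forall m, (n <= m)%N -> a / m%:R <= e.
Proof.
move=> e0; have [n Hn] := nat_above (a / e); exists n.+1; split=> // m nm.
have m0 : 0 < m%:R :> R by rewrite ltr0n; lia.
by rewrite ler_pdivrMr // mulrC -ler_pdivrMr // Hn // ltnW.
Qed.

(** Cell [c] receives the integer part of [B] times its mass. The density in the resulting
    permutation is compared with sampling with replacement, then with cells under the weights [w],
    then under the masses [g], and finally with [G]. *)
Lemma permuton_approx (e : R) K L : 0 < e -> exists N (sigma : 'S_N), (L <= N)%N /\
  forall k (pi : 'S_k), (k <= K)%N ->
  `|rho (N%:R : R) pi sigma - rho_permuton G pi| <= e.
Proof.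
move=> e0; have e8 : 0 < e / 8 by rewrite divr_gt0.
have [n [n0 /(_ n (leqnn n)) nE]] := nat_above_ratio (K%:R * K%:R * 2) e8.
pose C := ('I_n.+1 * 'I_n.+1)%type; pose cn := #|{: C}|.
have [B1 [B10 B1E]] := nat_above_ratio (K%:R * (2 * cn%:R)) e8.
have [N1 [N10 N1E]] := nat_above_ratio (K%:R * K%:R) e8.
(* Rounding loses at most one point per cell, so [N >= B - cn]; the other summands make [N] exceed
   [N1], [K] and [L]. *)
pose B := (B1 + cn + N1 + K + L + 1)%N.
pose g := cell_mass G (n := n).
have g0 c : 0 <= g c by exact: cell_mass_ge0.
have g1 : \sum_c g c = 1 by exact: cell_mass_total.
have B0 : 0 < B%:R :> R by rewrite ltr0n /B; lia.
pose m (c : C) := Num.truncn (B%:R * g c).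
have Bg0 c : 0 <= B%:R * g c by rewrite mulr_ge0.
have mlo c : (m c)%:R <= B%:R * g c by have /andP[] := truncn_itv (Bg0 c).
have mhi c : B%:R * g c <= (m c)%:R + 1.
  by have /andP[_ /ltW] := truncn_itv (Bg0 c); rewrite natr1.
have [N [sigma [phi [cnt NE mono1 mono2]]]] := perm_of_cell_counts m.
have NRE : N%:R = \sum_c (m c)%:R :> R by rewrite NE natr_sum.
have BE : B%:R = \sum_c B%:R * g c by rewrite -mulr_sumr g1 mulr1.
have NB : N%:R <= B%:R :> R.
  by rewrite NRE BE; apply: ler_sum => c _.
have BN : B%:R <= N%:R + cn%:R :> R.
  rewrite BE NRE /cn -sum1_card natr_sum -big_split /=.
  by apply: ler_sum => c _.
have BNn : (B <= N + cn)%N by rewrite -(ler_nat R) natrD.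
have N0 : 0 < N%:R :> R by rewrite ltr0n; lia.
exists N, sigma; split=> [|k pi kK]; first by lia.
have kN : (k < N)%N by lia.
have N1N : (N1 <= N)%N by lia.
have kKR : k%:R <= K%:R :> R by rewrite ler_nat.
have kKK : k%:R * k%:R <= K%:R * K%:R :> R by rewrite ler_pM.
pose w (c : C) : R := \sum_(p | phi p == c) N%:R^-1.
have wE c : w c = (m c)%:R / N%:R.
  rewrite /w sumr_const -cnt -[LHS]mulr_natl; congr (_%:R * _).
  by apply: eq_card => i; rewrite !inE.
have w0 c : 0 <= w c by rewrite wE divr_ge0.
have w1 : \sum_c w c = 1.
  under eq_bigr do rewrite wE.
  by rewrite -mulr_suml -NRE divff // gt_eqF.
have dist : \sum_c `|g c - w c| <= 2 * cn%:R / B%:R.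
  (* Both [g c] and [w c] are at least [m c / B]; the sum of the two excesses is
     [2 * (1 - N / B)]. *)
  apply: (@le_trans _ _ (\sum_c ((w c - (m c)%:R / B%:R) + (g c - (m c)%:R / B%:R)))).
    apply: ler_sum => c _.
    have h1 : (m c)%:R / B%:R <= g c by rewrite ler_pdivrMr // mulrC.
    have h2 : (m c)%:R / B%:R <= w c.
      by rewrite wE ler_wpM2l // lef_pV2 ?posrE.
    by rewrite ler_norml; apply/andP; split; lra.
  rewrite big_split /= !sumrB w1 g1 -mulr_suml -NRE.
  have : 1 - N%:R / B%:R <= cn%:R / B%:R :> R.
    by rewrite lerBlDr -mulrDl ler_pdivlMr // mul1r addrC.
  by rewrite mulrAC; lra.
pose A := fun s : seq C => (pat_event pi (map (@cell_point R n.+1) s) && separated s)%:R : R.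
pose D := fun s : seq C => (~~ separated s)%:R : R.
have kdist : k%:R * \sum_c `|g c - w c| <= e / 8.
  apply: le_trans (B1E B _); last by rewrite /B; lia.
  rewrite -mulrA ler_pM // ?sumr_ge0 //.
have AL : `|dint g k A - dint w k A| <= e / 8.
  apply: le_trans kdist; apply: dint_lipschitz => // s.
  by rewrite /A ler0n lern1 leq_b1.
have DL : `|dint g k D - dint w k D| <= e / 8.
  apply: le_trans kdist; apply: dint_lipschitz => // s.
  by rewrite /D ler0n lern1 leq_b1.
have kn : k%:R * k%:R * (2 / n%:R) <= e / 8.
  apply: le_trans nE; rewrite -!mulrA mulrA [leRHS]mulrA ler_wpM2r // divr_ge0 //.
have Dg : dint g k D <= e / 8.
  apply: le_trans kn; apply: dint_pairwise => // c.
  exact: cell_mass_share.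
have GA : `|rho_permuton G pi - dint g k A| <= e / 8.
  by apply: le_trans kn; apply: rho_permuton_cells.
pose F := fun s : seq 'I_N => (pat_event pi (map (perm_point R sigma) s))%:R : R.
have sandwich (s : seq 'I_N) : size s = k ->
    A (map phi s) <= F s <= A (map phi s) + D (map phi s).
  move=> sk; rewrite /A /D /F; case: (boolP (separated _)) => sep /=.
    rewrite -(@pat_event_cells R _ _ _ pi (perm_point R sigma) phi s) //.
    - by rewrite andbT addr0 lexx.
    - by move=> p q /mono1; rewrite ltr_nat.
    - by move=> p q /mono2; rewrite ltr_nat.
  by rewrite andbF add0r; case: pat_event; rewrite ?lexx ?ler01.
have V0 : forall i : 'I_N, 0 <= (fun=> N%:R^-1 : R) i by move=> i; rewrite invr_ge0.
have lo : dint w k A <= dint (fun=> N%:R^-1) k F.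
  rewrite -dint_map; apply: dint_le => // s sk.
  by have /andP[] := sandwich s sk.
have hi : dint (fun=> N%:R^-1) k F <= dint w k A + dint w k D.
  rewrite -dintD -(dint_map phi _ k (fun s => A s + D s)); apply: dint_le => // s sk.
  by have /andP[] := sandwich s sk.
have fin : `|dint (fun=> N%:R^-1) k F - rho (N%:R : R) pi sigma| <= e / 8.
  apply: le_trans (dint_perm_rho R sigma pi kN) _.
  apply: le_trans (N1E N N1N).
  by rewrite ler_wpM2r // invr_ge0.
(* Five errors of [e / 8] add up: two for [D] under [w], one each for [A], for [G] and for
   sampling. *)
move: lo hi Dg AL DL GA fin; rewrite !ler_norml.
move: (dint g k A) (dint w k A) (dint g k D) (dint w k D) (dint _ k F) (rho _ _ _)
  (rho_permuton _ _) => a b c d f r p.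
clear -e0; move=> h1 h2 h3 /andP[a1 a2] /andP[b1 b2] /andP[c1 c2] /andP[d1 d2].
by apply/andP; split; lra.
Qed.

End PermutonApproximation.

(** * Joint approximation at all scales *)

Section Limits.
Variable R : realType.

Lemma cvg_eventually (u : nat -> R) (l : R) :
  (u @ \oo --> l)%classic <->
  forall e, 0 < e -> exists J : nat, forall j : nat, (J <= j)%N -> `|u j - l| <= e.
Proof.
split=> [/cvgrPdist_le H e e0|H].
  have [J _ HJ] := H e e0; exists J => j Jj.
  by rewrite distrC; apply: HJ.
apply/cvgrPdist_le => e e0; have [J HJ] := H e e0.
by exists J => // j /= Jj; rewrite distrC HJ.
Qed.

Lemma cvgy_eventually (u : nat -> R) : (u @ \oo --> +oo)%classic ->
  forall a : R, exists J : nat, forall j : nat, (J <= j)%N -> a <= u j.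
Proof.
move=> /cvgryPge H a; have [J _ HJ] := H a; exists J => j Jj; exact: HJ.
Qed.

(** There are finitely many patterns of size at most [K], so the largest of their indices serves for
    all. *)
Lemma uniform_index (P : forall k, 'S_k -> nat -> Prop) K :
  (forall k (pi : 'S_k), exists J : nat, forall j : nat, (J <= j)%N -> P k pi j) ->
  exists J : nat, forall j : nat, (J <= j)%N -> forall k (pi : 'S_k), (k <= K)%N -> P k pi j.
Proof.
move=> H; pose J k pi := sval (cid (H k pi)).
exists (\max_(k < K.+1) \max_(pi : 'S_k) J k pi)%N => j Jj k pi kK.
rewrite -ltnS in kK; apply: (svalP (cid (H k pi))).
apply: leq_trans Jj; apply: leq_trans (leq_bigmax (Ordinal kK)) => /=.
exact: leq_bigmax.
Qed.

Lemma local_limit_approx (Lam : forall k, 'S_k -> R) : local_limit Lam ->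
  forall e K L, 0 < e -> exists N (lam : 'S_N), (L <= N)%N /\
  forall k (pi : 'S_k), (k <= K)%N -> `|rho (k%:R : R) pi lam - Lam k pi| <= e.
Proof.
move=> [s [sz cv]] e K L e0; have [J1 H1] := sz L.
have [J2 H2] := @uniform_index (fun k pi j =>
  `|rho (k%:R : R) pi (projT2 (s j)) - Lam k pi| <= e) K
  (fun k pi => (cvg_eventually _ _).1 (cv k pi) e e0).
exists (projT1 (s (maxn J1 J2))), (projT2 (s (maxn J1 J2))); split.
  by apply: H1; rewrite leq_maxl.
by apply: H2; rewrite leq_maxr.
Qed.

(** The scaling function through which [Xi] arises is forgotten here. A permutation and an integer
    scale [a] remain, with [a] large but small against [N], and these can be transported to another
    scale. *)
Lemma scale_limit_approx (Xi : forall k, 'S_k -> R) : scale_limit Xi ->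
  forall e K L, 0 < e -> exists N (alpha : 'S_N) a,
  [/\ (L <= a)%N, a%:R <= e * N%:R &
  forall k (pi : 'S_k), (k <= K)%N -> `|rho (a%:R : R) pi alpha - Xi k pi| <= e].
Proof.
move=> [f [s [[fpos fy f0] [sz cv]]]] e K L e0.
have [n1 Hn1] := cvgy_eventually fy L%:R.
have [n2 Hn2] := (cvg_eventually _ _).1 f0 e e0.
have [J1 H1] := sz (n1 + n2 + 1)%N.
have [J2 H2] := @uniform_index (fun k pi j =>
  `|rho (f (projT1 (s j))) pi (projT2 (s j)) - Xi k pi| <= e) K
  (fun k pi => (cvg_eventually _ _).1 (cv k pi) e e0).
pose j := maxn J1 J2.
have {}H1 := H1 j (leq_maxl _ _); have {}H2 := H2 j (leq_maxr _ _).
move: H1 H2; case: (s j) => N alpha /= H1 H2.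
have N0 : (0 < N)%N by lia.
have [fN0 fNN] := fpos N N0.
exists N, alpha, (Num.truncn (f N)); split.
- by rewrite truncn_ge_nat ?(ltW fN0) // Hn1 //; lia.
- apply: (@le_trans _ _ (f N)); first by rewrite truncn_le (ltW fN0).
  have NR : 0 < N%:R :> R by rewrite ltr0n.
  have n2N : (n2 <= N)%N by lia.
  have := Hn2 N n2N; rewrite subr0 ger0_norm ?divr_ge0 ?(ltW fN0) //.
  by rewrite ler_pdivrMr.
- by move=> k pi kK; rewrite -rho_truncn ?(ltW fN0) //; exact: H2.
Qed.

End Limits.

(** * Successive wrapping along the chain of scales *)

Section Assembly.
Variables (R : realType) (f : nat -> nat -> R) (Xi : nat -> forall k, 'S_k -> R).
Variables (Lam : forall k, 'S_k -> R).
Hypothesis fS : forall t, scaling (f t).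
Hypothesis XiS : forall t, scale_limit (Xi t).
Hypothesis LamL : local_limit Lam.

(* The scales are taken at the size [n] of the permutation to be built, of which
   [tau], of size [M], is a building block. *)
Definition approximates (P : pred nat) (n : nat) (e : R) (K : nat) M (tau : 'S_M) : Prop :=
  [/\ (0 < M)%N,
      K%:R <= e * M%:R,
      forall k (pi : 'S_k), (k <= K)%N -> `|rho (k%:R : R) pi tau - Lam pi| <= e &
      forall t, P t -> [/\ K%:R <= f t n, f t n <= e * M%:R &
        forall k (pi : 'S_k), (k <= K)%N -> `|rho (f t n) pi tau - Xi t pi| <= e]].

(** The constant [C] may depend on [e] and [K] but not on [n]. The size is thus of order [h n],
    which leaves room for wrapping at any scale that dominates [h]. *)
Definition approximable (P : pred nat) (h : nat -> R) : Prop :=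
  forall (e : R) K, 0 < e -> exists (C : R) (n0 : nat), forall n : nat, (n0 <= n)%N ->
  exists M (tau : 'S_M), approximates P n e K tau /\ M%:R <= C * h n.

Lemma approximable_local : approximable pred0 (fun=> 1).
Proof.
move=> e K e0; have [L HL] := nat_above (K%:R / e).
have [N [lam [LN Hlam]]] := local_limit_approx LamL K (maxn L 1) e0.
exists N%:R, 0%N => n _; exists N, lam; split; last by rewrite mulr1.
split=> //.
- by apply: leq_trans LN; rewrite leq_maxr.
- by rewrite mulrC -ler_pdivrMr // HL // (leq_trans _ LN) // leq_maxl.
Qed.

(** All scales already treated are at most [e * M], so [rho_combine_fine] changes their densities by
    at most [2 * e]; together with the former error this gives [3 * e]. *)
Lemma approximates_combine (P : pred nat) n (e : R) K M (tau : 'S_M) N (beta : 'S_N) c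
    (M0 : (0 < M)%N) (c0 : (0 < c)%N) :
  0 < e -> e <= 1 / 2 -> (0 < N)%N ->
  approximates P n e K tau -> M%:R <= e * c%:R ->
  approximates P n (3 * e) K (combine beta tau M0 c0).
Proof.
move=> e0 e2 N0 [_ KM loc sc] Mc.
have MR : 0 < M%:R :> R by rewrite ltr0n.
have cR : 0 < c%:R :> R by rewrite ltr0n.
have NR : 1 <= N%:R :> R by rewrite ler1n.
have Mc1 : M%:R <= c%:R :> R by apply: (le_trans Mc); rewrite ler_piMl //; lra.
have cNc : c%:R <= (N * c)%:R :> R by rewrite natrM ler_peMl.
have McE : M%:R / c%:R <= e by rewrite ler_pdivrMr.
have half : e * M%:R < M%:R by rewrite gtr_pMl //; lra.
have big : e * M%:R <= 3 * e * (N * c)%:R.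
  apply: ler_pM; rewrite ?(ltW e0) //; [lra|exact: le_trans cNc].
have fine k (pi : 'S_k) x : (k <= x)%N -> x%:R <= e * M%:R ->
    `|rho (x%:R : R) pi (combine beta tau M0 c0) - rho (x%:R : R) pi tau| <= 2 * e.
  move=> kx xM.
  apply: (@le_trans _ _ (M%:R / c%:R + x%:R / M%:R)).
    apply: rho_combine_fine => //; last by rewrite -(ler_nat R).
    by rewrite -(ltr_nat R); apply: le_lt_trans half.
  have : x%:R / M%:R <= e by rewrite ler_pdivrMr.
  lra.
split.
- by rewrite muln_gt0 N0 c0.
- exact: le_trans big.
- move=> k pi kK.
  have kM : k%:R <= e * M%:R by apply: le_trans KM; rewrite ler_nat.
  have := fine k pi k (leqnn k) kM; have := loc k pi kK.
  by rewrite !ler_norml => /andP[? ?] /andP[? ?]; apply/andP; split; lra.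
- move=> t Pt; have [Kf fM Hsc] := sc t Pt; split=> //; first exact: le_trans big.
  move=> k pi kK; have f0 : 0 <= f t n by apply: le_trans Kf.
  have kx : (k <= Num.truncn (f t n))%N.
    by rewrite truncn_ge_nat //; apply: le_trans Kf; rewrite ler_nat.
  have xM : (Num.truncn (f t n))%:R <= e * M%:R by apply: le_trans fM; rewrite truncn_le.
  have := fine k pi _ kx xM; have := Hsc k pi kK.
  rewrite !(rho_truncn _ _ f0).
  by rewrite !ler_norml => /andP[? ?] /andP[? ?]; apply/andP; split; lra.
Qed.

Lemma approximates_weaken P n e e' K M (tau : 'S_M) : e <= e' ->
  approximates P n e K tau -> approximates P n e' K tau.
Proof.
move=> ee' [M0 KM loc sc].
have eM : e * M%:R <= e' * M%:R by rewrite ler_wpM2r.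
split=> //.
- exact: le_trans eM.
- by move=> k pi kK; apply: le_trans (loc k pi kK) _.
- move=> t Pt; have [Kf fM Hsc] := sc t Pt; split=> //; first exact: le_trans eM.
  by move=> k pi kK; apply: le_trans (Hsc k pi kK) _.
Qed.

Lemma dominated_eventually (h g : nat -> R) (C d : R) : dominated h g -> 0 < d ->
  (forall n, (0 < n)%N -> 0 < g n) ->
  exists n0 : nat, forall n, (n0 <= n)%N -> C * h n <= d * g n.
Proof.
move=> dom d0 g0; have C0 : 0 < `|C| + 1 by rewrite ltr_wpDl.
have [J HJ] := (cvg_eventually _ _).1 dom (d / (`|C| + 1)) (divr_gt0 d0 C0).
exists J.+1 => n Jn; have gn : 0 < g n by apply: g0; lia.
have := HJ n (ltnW Jn); rewrite subr0 normrM normfV (gtr0_norm gn) => H.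
apply: (le_trans (ler_norm _)); rewrite normrM.
rewrite -ler_pdivrMr // -mulrA.
apply: (@le_trans _ _ ((`|C| + 1) * (d / (`|C| + 1)))).
  by apply: ler_pM => //; [rewrite divr_ge0 // (ltW gn)|rewrite lerDl].
by rewrite mulrC divfK // gt_eqF.
Qed.

(** Wrap [tau], of size at most [C * h n], into [alpha] with blocks of length [c], the integer part
    of [f u n / a]. Domination makes [tau] small against [c], scale [a] of [alpha] becomes scale
    [f u n], and the size [N * c] is at most [N * f u n]. *)
Lemma approximable_step P h u : approximable P h -> dominated h (f u) ->
  approximable (fun t => (t == u) || P t) (f u).
Proof.
move=> IH dom e K e0; have [fpos fy _] := fS u.
(* The divisor leaves room for the factor 3 of [approximates_combine] and for the four errors at the
   new scale; the minimum with 1 gives [e' <= 1 / 2] and [a < N]. *)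
pose e' := Num.min e 1 / 16.
have [e'0 e'e e'1] : [/\ 0 < e', e' <= e / 16 & e' <= 1 / 16].
  split; first by rewrite divr_gt0 // lt_min e0 ltr01.
    by rewrite ler_wpM2r // ge_min lexx.
  by rewrite ler_wpM2r // ge_min lexx orbT.
have [C [n1 H1]] := IH e' K e'0.
have [L1 [L10 HL1]] := nat_above_ratio (K%:R * K%:R) e'0.
have [N [alpha [a [La aN Xa]]]] := scale_limit_approx (XiS u) K (L1 + K + 1)%N e'0.
have [c1 [c10 Hc1]] := nat_above_ratio K%:R e'0.
have a0 : (0 < a)%N by lia.
have Ka : (K <= a)%N by lia.
have L1a : (L1 <= a)%N by lia.
have aR : 0 < a%:R :> R by rewrite ltr0n.
have N0 : (0 < N)%N.
  by case: (posnP N) aN => // ->; rewrite mulr0 => /(lt_le_trans aR); rewrite ltxx.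
have NR : 0 < N%:R :> R by rewrite ltr0n.
have aN' : (a < N)%N.
  by rewrite -(ltr_nat R); apply: (le_lt_trans aN); rewrite gtr_pMl //; lra.
(* As [f u n <= 2 * a * c] will hold, this constant turns domination into [M <= e' * c]. *)
have d0 : 0 < e' / (2 * a%:R) by rewrite divr_gt0 // mulr_gt0.
have [n2 H2] := dominated_eventually C dom d0 (fun n n0 => (fpos n n0).1).
have [n3 H3] := cvgy_eventually fy ((c1 * a + K)%:R).
exists N%:R, (n1 + n2 + n3 + 1)%N => n nn.
have [fn0 _] : 0 < f u n /\ f u n <= n%:R by apply: fpos; lia.
have n1n : (n1 <= n)%N by lia.
have n2n : (n2 <= n)%N by lia.
have n3n : (n3 <= n)%N by lia.
have [M [tau [Htau MC]]] := H1 n n1n.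
have {}H2 := H2 n n2n; have {}H3 := H3 n n3n.
pose x := Num.truncn (f u n); pose c := (x %/ a)%N.
have xf : x%:R <= f u n by rewrite truncn_le (ltW fn0).
have fx : f u n < x.+1%:R by exact: truncnS_gt.
have x1 : (c1 * a + K <= x)%N by rewrite truncn_ge_nat // (ltW fn0).
have c1c : (c1 <= c)%N by rewrite leq_divRL // (leq_trans _ x1) // leq_addr.
have c0 : (0 < c)%N := leq_trans c10 c1c.
have acx : (a * c <= x)%N by rewrite mulnC leq_trunc_div.
have xac : (x.+1 <= a * c.+1)%N by rewrite mulnC; apply: ltn_ceil.
have cR : 1 <= c%:R :> R by rewrite ler1n.
have fac : f u n <= 2 * a%:R * c%:R.
  apply: (le_trans (ltW fx)); apply: (@le_trans _ _ (a * c.+1)%:R); first by rewrite ler_nat.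
  have : a%:R <= a%:R * c%:R :> R by rewrite ler_peMr.
  by rewrite natrM -natr1 mulrDr mulr1; lra.
have Mc : M%:R <= e' * c%:R.
  apply: (le_trans MC); apply: (le_trans H2).
  apply: (@le_trans _ _ (e' / (2 * a%:R) * (2 * a%:R * c%:R))).
    by rewrite ler_wpM2l // ltW.
  by rewrite mulrA divfK // gt_eqF // mulr_gt0.
have [M0 _ _ _] := Htau.
have e'2 : e' <= 1 / 2 by lra.
have Hcomb := approximates_combine alpha M0 c0 e'0 e'2 N0 Htau Mc.
exists (N * c)%N, (combine alpha tau M0 c0); split; last first.
  rewrite natrM ler_wpM2l // (le_trans _ xf) // ler_nat.
  by rewrite (leq_trans _ acx) // leq_pmull.
have e3 : 3 * e' <= e by lra.
have [? ? ? sc] := approximates_weaken e3 Hcomb; split=> // t /predU1P[->|Pt]; last exact: sc.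
split.
- by apply: le_trans H3; rewrite ler_nat leq_addl.
- apply: (le_trans fac); rewrite natrM mulrA ler_wpM2r //.
  apply: (@le_trans _ _ (2 * (e' * N%:R))); first by rewrite ler_wpM2l.
  by rewrite mulrA ler_wpM2r //; lra.
- move=> k pi kK; rewrite (rho_truncn _ _ (ltW fn0)) -/x.
  have ka := leq_trans kK Ka.
  have := rho_combine_coarse R alpha tau M0 c0 N0 pi a0 ka aN' acx (ltnW xac).
  have := Xa k pi kK.
  have b1 : a%:R / N%:R <= e' by rewrite ler_pdivrMr.
  have kR : k%:R <= K%:R :> R by rewrite ler_nat.
  have b2 : k%:R * c.+1%:R^-1 <= e'.
    apply: le_trans (Hc1 c.+1 (leqW c1c)).
    by rewrite ler_wpM2r // invr_ge0.
  have b3 : k%:R * (k%:R / a%:R) <= e'.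
    apply: le_trans (HL1 a L1a).
    by rewrite mulrA ler_wpM2r ?invr_ge0 // ler_pM.
  rewrite mulrDr; move: b1 b2 b3 e'e; clear -e'0.
  move: (a%:R / N%:R) (k%:R * c.+1%:R^-1) (k%:R * (k%:R / a%:R)) => p q r b1 b2 b3 e'e.
  move: (rho _ _ _) (rho _ _ _) (Xi u pi) => y z w.
  rewrite !ler_norml => /andP[h1 h2] /andP[h3 h4]; apply/andP; split; lra.
Qed.

Hypothesis ford : forall t u, t <> u -> dominated (f t) (f u) \/ dominated (f u) (f t).

(** Sort the indices up to [m] by domination and wrap in this order, starting from the local
    approximation, whose bounded size every scaling function dominates. The index [u] is the last in
    the order. *)
Lemma approximable_initial m : exists P u, approximable P (f u) /\
  forall t, (t <= m)%N -> P t.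
Proof.
pose D t u := (t == u) || `[< dominated (f t) (f u) >].
have Dtot : total D.
  move=> t u; rewrite /D eq_sym; case: eqP => //= /ford[] /asboolP-> //.
  by rewrite orbT.
(* The invariant [P u] settles the case of equal neighbours, where nothing is wrapped. *)
have climb l : forall u (P : pred nat), approximable P (f u) -> P u -> path D u l ->
    exists P' v, approximable P' (f v) /\ forall t, P t || (t \in l) -> P' t.
  elim: l => [|v l IH] u P HP Pu /=.
    by move=> _; exists P, u; split=> // t; rewrite in_nil orbF.
  case/andP=> /orP[/eqP uv|/asboolP uv] pl.
    subst v; have [P' [w [H1 H2]]] := IH u P HP Pu pl.
    exists P', w; split=> // t; rewrite in_cons => /or3P[Pt|/eqP->|tl]; apply: H2.
    + by rewrite Pt.
    + by rewrite Pu.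
    + by rewrite tl orbT.
  have [||P' [w [H1 H2]]] := IH v _ (approximable_step HP uv); rewrite ?eqxx //.
  exists P', w; split=> // t; rewrite in_cons => /or3P[Pt|/eqP->|tl]; apply: H2.
  + by rewrite Pt orbT.
  + by rewrite eqxx.
  + by rewrite tl orbT.
have : forall t, (t <= m)%N -> t \in sort D (iota 0 m.+1).
  by move=> t tm; rewrite mem_sort mem_iota.
have := sort_sorted Dtot (iota 0 m.+1).
case: (sort D _) => [|u l] /= pl Hl; first by have := Hl 0%N (leq0n _).
have dom1 : dominated (fun=> 1) (f u).
  have [_ fy _] := fS u; apply/cvg_eventually => e e0.
  have [J HJ] := cvgy_eventually fy e^-1; exists J => j Jj.
  have fe := HJ j Jj; have f0 : 0 < f u j by apply: lt_le_trans fe; rewrite invr_gt0.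
  by rewrite subr0 mul1r gtr0_norm ?invr_gt0 // -[e]invrK lef_pV2 ?posrE // invr_gt0.
have [||P [v [H1 H2]]] := climb l u _ (approximable_step approximable_local dom1); rewrite ?eqxx //.
exists P, v; split=> // t /Hl; rewrite in_cons => /orP[/eqP->|tl]; apply: H2.
  by rewrite eqxx.
by rewrite tl orbT.
Qed.

Variable G : {measure set (R * R)%type -> \bar R}.
Hypothesis GP : permuton G.

(** The last wrapping is into an approximation of the permuton: scaling functions are dominated by
    [n], so the blocks can be made long against [tau]. *)
Lemma joint_approximation (e : R) K : 0 < e -> exists n (tau : 'S_n), [/\ (K <= n)%N,
  forall t, (t <= K)%N -> forall k (pi : 'S_k), (k <= K)%N ->
    `|rho (f t n) pi tau - Xi t pi| <= e,
  forall k (pi : 'S_k), (k <= K)%N -> `|rho (n%:R : R) pi tau - rho_permuton G pi| <= e &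
  forall k (pi : 'S_k), (k <= K)%N -> `|rho (k%:R : R) pi tau - Lam pi| <= e].
Proof.
move=> e0; have [P [u [HP HPt]]] := approximable_initial K.
have [fpos _ f0] := fS u.
pose e' := Num.min e 1 / 16.
have [e'0 e'e e'1] : [/\ 0 < e', e' <= e / 16 & e' <= 1 / 16].
  split; first by rewrite divr_gt0 // lt_min e0 ltr01.
    by rewrite ler_wpM2r // ge_min lexx.
  by rewrite ler_wpM2r // ge_min lexx orbT.
have [C [n1 H1]] := HP e' K e'0.
have [L1 [L10 HL1]] := nat_above_ratio (K%:R * K%:R) e'0.
have [N [gamma [LN Hgamma]]] := permuton_approx GP K (L1 + K + 1)%N e'0.
have N0 : (0 < N)%N by lia.
have NR : 0 < N%:R :> R by rewrite ltr0n.
have d0 : 0 < e' / N%:R by rewrite divr_gt0.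
have [n2 H2] := dominated_eventually C (f0 : dominated (f u) (fun n => n%:R)) d0
  (fun n n0 => etrans (ltr0n R n) n0).
(* The scales are evaluated at the final size, so [n] is fixed before [tau] is taken. *)
pose c := (n1 + n2 + 1 + K)%N; pose n := (N * c)%N.
have c0 : (0 < c)%N by rewrite /c; lia.
have cn : (c <= n)%N by rewrite leq_pmull.
have n1n : (n1 <= n)%N by apply: leq_trans cn; rewrite /c; lia.
have n2n : (n2 <= n)%N by apply: leq_trans cn; rewrite /c; lia.
have [M [tau [Htau MC]]] := H1 n n1n.
have Mc : M%:R <= e' * c%:R.
  apply: (le_trans MC); apply: (le_trans (H2 n n2n)).
  by rewrite natrM mulrA divfK // gt_eqF.
have [M0 _ _ _] := Htau.
have e'2 : e' <= 1 / 2 by lra.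
have e3 : 3 * e' <= e by lra.
have := approximates_combine gamma M0 c0 e'0 e'2 N0 Htau Mc.
move=> /(approximates_weaken e3) [_ _ loc sc].
exists n, (combine gamma tau M0 c0); split=> //.
- by apply: leq_trans cn; rewrite leq_addl.
- by move=> t /HPt /sc[].
- move=> k pi kK; have kN : (k < N)%N by lia.
  have := rho_combine_global R gamma tau M0 c0 N0 pi kN; have := Hgamma k pi kK.
  have b : k%:R * k%:R / N%:R <= e'.
    apply: le_trans (HL1 N _); last by lia.
    by rewrite ler_wpM2r ?invr_ge0 // ler_pM // ler_nat.
  rewrite -/n; move: b; clear -e3 e'0.
  move: (_ / _) (rho _ _ _) (rho _ _ _) (rho_permuton _ _) => p y z w b.
  by rewrite !ler_norml => /andP[h1 h2] /andP[h3 h4]; apply/andP; split; lra.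
Qed.

End Assembly.

Theorem mainTheorem9 (R : realType) (f : nat -> nat -> R)
    (Xi : nat -> forall k, 'S_k -> R)
    (G : {measure set (R * R)%type -> \bar R}) (Lam : forall k, 'S_k -> R) :
  (forall t, scaling (f t)) ->
  (forall t u, t <> u -> dominated (f t) (f u) \/ dominated (f u) (f t)) ->
  (forall t, scale_limit (Xi t)) ->
  permuton G ->
  local_limit Lam ->
  exists tau : nat -> {n : nat & 'S_n},
    sizes_to_infty tau /\
    (forall t, conv_scale (f t) tau (Xi t)) /\
    conv_global tau G /\
    conv_local tau Lam.
Proof.
move=> fS ford XiS GP LamL.
have e0 m : 0 < m.+1%:R^-1 :> R by rewrite invr_gt0.
(* Member [m] of the diagonal sequence handles the scales [t <= m] and the patterns of size at most
   [m] with error [1 / (m + 1)]; each fixed scale and pattern is covered from some [m] on. *)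
have H m := joint_approximation fS XiS LamL ford GP m (e0 m).
have {}H m : exists tau : {n : nat & 'S_n}, [/\ (m <= projT1 tau)%N,
    forall t, (t <= m)%N -> forall k (pi : 'S_k), (k <= m)%N ->
      `|rho (f t (projT1 tau)) pi (projT2 tau) - Xi t k pi| <= m.+1%:R^-1,
    forall k (pi : 'S_k), (k <= m)%N ->
      `|rho ((projT1 tau)%:R : R) pi (projT2 tau) - rho_permuton G pi| <= m.+1%:R^-1 &
    forall k (pi : 'S_k), (k <= m)%N ->
      `|rho (k%:R : R) pi (projT2 tau) - Lam k pi| <= m.+1%:R^-1].
  by have [n [tau Htau]] := H m; exists (existT _ n tau).
have [tau Htau] := choice H.
have sz : sizes_to_infty tau.
  move=> N; exists N => m Nm; have [h _ _ _] := Htau m.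
  exact: leq_trans h.
have eventually_small (u : nat -> R) (l : R) (J : nat) :
    (forall m, (J <= m)%N -> `|u m - l| <= m.+1%:R^-1) -> (u @ \oo --> l)%classic.
  move=> Hu; apply/cvg_eventually => e ep.
  have [n [_ Hn]] := nat_above_ratio 1 ep; exists (maxn J n) => m.
  rewrite geq_max => /andP[Jm nm]; apply: le_trans (Hu m Jm) _.
  by have := Hn m.+1 (leqW nm); rewrite mul1r.
exists tau; split=> //; split; [|split].
- move=> t; split=> // k pi; apply: (eventually_small _ _ (maxn t k)) => m.
  rewrite geq_max => /andP[tm km]; have [_ h _ _] := Htau m; exact: h.
- move=> k pi; apply: (eventually_small _ _ k) => m km.
  by have [_ _ h _] := Htau m; exact: h.
- split=> // k pi; apply: (eventually_small _ _ k) => m km.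
  by have [_ _ _ h] := Htau m; exact: h.
Qed.
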